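(* Let $a>0$, $b>0$, $c>0$ and put $\Phi(x)={}_1F_2\left(a\,;b,c\,;-\frac{x^2}{4}\right)$ for $x>0$. If $(a,b,c)\in\mathcal{P}_{1,2}$, then necessarily $b>a$, $c>a$ and $b+c\ge 3a+\frac12$. Moreover: (i) If $0<b\le a$, then $\Phi$ alternates in sign and has at least one zero on the interval $(0,j_{c-1}]$; if $0<c\le a$, then $\Phi$ alternates in sign and has at least one zero on $(0,j_{b-1}]$. (ii) Suppose that either ($b\le a+\frac12$ and $c\le 2a$) or ($b\le 2a$ and $c\le a+\frac12$), and in addition $b+c<3a+\frac12$. Then $\Phi$ alternates in sign and has at least one zero on the interval $\left(0,\,2j_{a-\frac12}\right)$.
   Context: For $a,b,c>0$, ${}_1F_2\left(a\,;b,c\,;-\frac{x^2}{4}\right)=\sum_{k=0}^\infty \frac{(a)_k}{k!\,(b)_k(c)_k}\left(-\frac{x^2}{4}\right)^k$, where $(\alpha)_k=\Gamma(\alpha+k)/\Gamma(\alpha)$. $\mathcal{P}_{1,2}$ denotes the set of all triples $(a,b,c)$ of positive reals such that this function is $>0$ for all $x>0$. For $\alpha>-1$, $j_\alpha$ denotes the smallest positive zero of the Bessel function $J_\alpha$. ''$\Phi$ alternates in sign'' means that $\Phi$ takes both positive and negative values on $(0,\infty)$. *)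

(* Defs.v *)
From Stdlib Require Import Reals Arith.
From Coquelicot Require Import Coquelicot.
Open Scope R_scope.

Fixpoint poch (alpha : R) (k : nat) : R :=
  match k with
  | O => 1
  | S k' => poch alpha k' * (alpha + INR k')
  end.

Definition F12 (a b c z : R) : R :=
  Series (fun k => poch a k / (INR (Factorial.fact k) * poch b k * poch c k) * z ^ k).

Definition Phi (a b c x : R) : R := F12 a b c (- x ^ 2 / 4).

Definition Gamma (s : R) : R :=
  RInt_gen (fun t => Rpower t (s - 1) * exp (- t)) (at_right 0) (Rbar_locally p_infty).

Definition BesselJ (alpha x : R) : R :=
  Series (fun k => (-1) ^ k / (INR (Factorial.fact k) * Gamma (INR k + alpha + 1))
                   * Rpower (x / 2) (2 * INR k + alpha)).

Definition is_first_pos_zero (alpha j : R) : Prop :=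
  0 < j /\ BesselJ alpha j = 0 /\ (forall x, 0 < x < j -> BesselJ alpha x <> 0).

Definition in_P12 (a b c : R) : Prop :=
  0 < a /\ 0 < b /\ 0 < c /\ (forall x, 0 < x -> 0 < Phi a b c x).

Definition alternates (f : R -> R) : Prop :=
  (exists x, 0 < x /\ 0 < f x) /\ (exists y, 0 < y /\ f y < 0).

(* Main.v *)
Require Import Defs.
From Stdlib Require Import Reals Lra Lia.
From Coquelicot Require Import Coquelicot.
Open Scope R_scope.

(** With [y = x^2 / 4], [Phi a b c x] is the entire function [f] of [y] with
    coefficients [hyp a b c], and [J d y] below is 0F1(d; -y), a power times a Bessel
    function.  If [h] has coefficients [p k / (be + k)] then [y h' + be h = p], so
    [y^be h] increases where [p >= 0]: these resolvents preserve positivity.  Hence so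
    does, for [A <= B], the multiplier [(A)_k / (B)_k], an infinite product of factors
    [(A + n) / (B + n) * (1 + (B - A) / (A + n + k))].

    For [b <= a], raising [b] to [a] turns [f >= 0] into [J c >= 0]; in case (ii), raising
    [b, c] to [a + 1/2, 2 a] turns it into the square of [J (a + 1/2)] at [y / 4], which
    would then be positive even at zeros of [J].

    For the sum condition put [d = b + c - a].  The reverse multiplier, from [hyp a b c]
    to the coefficients of [J d], is an infinite product of factors
    [1 - (b - a) (c - a) / ((b + i + k) (c + i + k))], so it subtracts from a multiple
    of [f] only averages of [f], and these are O(y^(-a)) when [f >= 0].  Therefore
    [J d >= - C y^(-a)], while [J d] oscillates with amplitude [y^(1/4 - d/2)]; this
    forces [d / 2 - 1/4 >= a]. *)

(** * Entire power series and resolvents *)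

(** No asymptotic expansion enters. The obstacle in the sum condition is that [f >= 0] does not
    directly bound [f] from above; only its average [res b] is shown to decay. That decay is found
    where it is easy: raising [c] by a large integer makes the Bessel factor decay faster than any
    prescribed power, and the numerator parameter [a] then dictates the rate [y^(-a)]. Positivity
    allows the return to the original [c], because an average at [y] is controlled by an iterated
    average at [2 y]. The choice of [d] comes from [a + d = b + c]: the factors of the reverse
    multiplier then differ from 1 by terms of order [i^(-2)], so their product has a positive limit.
    Since [f] has no upper bound, the factors are never applied to an estimate of [f]; the induction
    follows the difference from [f], where [f] enters only through double resolvents, whose sum
    telescopes. Infinite products are reached from finite partial products by dominated convergence
    of the coefficients. *)

Definition entire (p : nat -> R) : Prop := forall x, CV_disk p x.

Lemma entire_CV_radius p x : entire p -> Rbar_lt (Rabs x) (CV_radius p).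
Proof.
  intros hp.
  assert (h : Rbar_le (Rabs (Rabs x + 1)) (CV_radius p)).
  { destruct (Rbar_le_dec (Rabs (Rabs x + 1)) (CV_radius p)) as [h|h]; [exact h|].
    apply Rbar_not_le_lt in h.
    exfalso; apply (CV_disk_outside p (Rabs x + 1) h).
    apply is_lim_seq_abs_0, ex_series_lim_0, hp. }
  eapply Rbar_lt_le_trans; [|exact h].
  simpl; rewrite (Rabs_pos_eq (Rabs x + 1)); pose proof (Rabs_pos x); lra.
Qed.

Lemma CV_radius_entire p : CV_radius p = p_infty -> entire p.
Proof.
  intros h x; apply CV_disk_inside; rewrite h; exact I.
Qed.

Lemma entire_ex p x : entire p -> ex_pseries p x.
Proof. intros hp; apply CV_disk_correct, hp. Qed.

Lemma entire_dominated p q M :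
  entire p -> (forall k, Rabs (q k) <= M * Rabs (p k)) -> entire q.
Proof.
  intros hp h x; unfold CV_disk.
  apply (@ex_series_le R_AbsRing R_CompleteNormedModule)
    with (b := fun k => M * Rabs (p k * x ^ k)).
  - intros k; change (norm (Rabs (q k * x ^ k))) with (Rabs (Rabs (q k * x ^ k))).
    rewrite Rabs_Rabsolu, !Rabs_mult, <- Rmult_assoc.
    apply Rmult_le_compat_r; [apply Rabs_pos|apply h].
  - apply (@ex_series_scal R_AbsRing R_NormedModule M _ (hp x)).
Qed.

Lemma entire_lin p q s t :
  entire p -> entire q -> entire (fun k => s * p k + t * q k).
Proof.
  intros hp hq x.
  apply (CV_disk_plus (PS_scal s p) (PS_scal t q)); apply CV_disk_scal; auto.
Qed.

Lemma PSeries_lin p q s t y :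
  entire p -> entire q ->
  PSeries (fun k => s * p k + t * q k) y = s * PSeries p y + t * PSeries q y.
Proof.
  intros hp hq.
  change (PSeries (PS_plus (PS_scal s p) (PS_scal t q)) y
          = s * PSeries p y + t * PSeries q y).
  rewrite PSeries_plus, !PSeries_scal; [reflexivity| |];
    apply ex_pseries_scal; try (intros; apply Rmult_comm); apply entire_ex; auto.
Qed.

Lemma entire_is_derive p y :
  entire p -> is_derive (PSeries p) y (PSeries (PS_derive p) y).
Proof. intros hp; apply is_derive_PSeries, entire_CV_radius, hp. Qed.

Lemma entire_continuity p : entire p -> continuity (PSeries p).
Proof.
  intros hp y; apply derivable_continuous_pt, ex_derive_Reals_0.
  eexists; apply entire_is_derive, hp.
Qed.

Lemma entire_derive p : entire p -> entire (PS_derive p).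
Proof.
  intros hp; apply CV_radius_entire.
  rewrite CV_radius_derive.
  destruct (CV_radius p) as [r| |] eqn:E; [exfalso| reflexivity|exfalso].
  - pose proof (entire_CV_radius p r hp) as h; rewrite E in h; simpl in h.
    pose proof (Rle_abs r); lra.
  - pose proof (entire_CV_radius p 0 hp) as h; rewrite E in h; exact h.
Qed.

(** Dominated convergence: the head up to [N] converges term by term, and the tail is at most twice
    that of the absolutely convergent series of [p], because all multipliers are bounded by 1. *)
Lemma PSeries_multiplier_lim p (mu : nat -> nat -> R) (nu : nat -> R) y :
  entire p ->
  (forall n k, Rabs (mu n k) <= 1) ->
  (forall k, is_lim_seq (fun n => mu n k) (nu k)) ->
  is_lim_seq (fun n => PSeries (fun k => mu n k * p k) y)
             (PSeries (fun k => nu k * p k) y).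
Proof.
  intros hp hmu hlim.
  assert (hnu : forall k, Rabs (nu k) <= 1).
  { intros k.
    apply (is_lim_seq_le (fun n => Rabs (mu n k)) (fun _ => 1) (Rabs (nu k)) 1).
    - intros n; apply hmu.
    - apply (is_lim_seq_abs _ (nu k)), hlim.
    - apply is_lim_seq_const. }
  assert (hem : forall n, entire (fun k => mu n k * p k)).
  { intros n; apply (entire_dominated p _ 1 hp); intros k.
    rewrite Rabs_mult; apply Rmult_le_compat_r; [apply Rabs_pos|auto]. }
  assert (hen : entire (fun k => nu k * p k)).
  { apply (entire_dominated p _ 1 hp); intros k.
    rewrite Rabs_mult; apply Rmult_le_compat_r; [apply Rabs_pos|auto]. }
  set (u := fun k => Rabs (p k * y ^ k)).
  assert (hu : ex_series u) by apply hp.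
  assert (hu0 : forall k, 0 <= u k) by (intros; apply Rabs_pos).
  assert (htail : is_lim_seq (fun N => Series (fun k => u (S N + k)%nat)) 0).
  { assert (h : is_lim_seq (fun N => Series u - sum_n u N) 0).
    { replace (Finite 0) with (Finite (Series u - Series u)) by (f_equal; ring).
      apply is_lim_seq_minus'; [apply is_lim_seq_const|].
      apply (Series_correct u hu). }
    revert h; apply is_lim_seq_ext; intros N.
    rewrite (Series_incr_n u (S N)); [|lia|exact hu].
    simpl pred; rewrite sum_n_Reals; ring. }
  apply is_lim_seq_spec; intros eps.
  apply is_lim_seq_spec in htail.
  assert (he4 : 0 < eps / 4) by (pose proof (cond_pos eps); lra).
  destruct (htail (mkposreal _ he4)) as [N hN'].
  assert (hN : Rabs (Series (fun k => u (S N + k)%nat) - 0) < eps / 4)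
    by exact (hN' N (le_n N)).
  assert (hfin : is_lim_seq (fun n => sum_n (fun k => Rabs (mu n k - nu k) * u k) N) 0).
  { clear hN hN'. induction N as [|N IH].
    - apply is_lim_seq_ext with (fun n => Rabs (mu n O - nu O) * u O).
      { intros; rewrite sum_O; reflexivity. }
      replace (Finite 0) with (Rbar_mult 0 (u O)) by (simpl; f_equal; ring).
      apply is_lim_seq_scal_r, (proj1 (is_lim_seq_abs_0 _)).
      replace (Finite 0) with (Finite (nu O - nu O)) by (f_equal; ring).
      apply is_lim_seq_minus'; [apply hlim|apply is_lim_seq_const].
    - apply is_lim_seq_ext with
        (fun n => sum_n (fun k => Rabs (mu n k - nu k) * u k) N
                  + Rabs (mu n (S N) - nu (S N)) * u (S N)).
      { intros; rewrite sum_Sn; reflexivity. }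
      replace (Finite 0) with (Finite (0 + 0)) by (f_equal; ring).
      apply is_lim_seq_plus'; [exact IH|].
      replace (Finite 0) with (Rbar_mult 0 (u (S N))) by (simpl; f_equal; ring).
      apply is_lim_seq_scal_r, (proj1 (is_lim_seq_abs_0 _)).
      replace (Finite 0) with (Finite (nu (S N) - nu (S N))) by (f_equal; ring).
      apply is_lim_seq_minus'; [apply hlim|apply is_lim_seq_const]. }
  apply is_lim_seq_spec in hfin.
  destruct (hfin (mkposreal _ he4)) as [n0 hn0].
  exists n0; intros n hn; specialize (hn0 n hn); simpl in hn0.
  rewrite Rminus_0_r in hn0, hN.
  assert (hd : PSeries (fun k => mu n k * p k) y - PSeries (fun k => nu k * p k) y
               = Series (fun k => (mu n k - nu k) * (p k * y ^ k))).
  { unfold PSeries; rewrite <- Series_minus.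
    - apply Series_ext; intros; ring.
    - apply (ex_series_Rabs _ (hem n y)).
    - apply (ex_series_Rabs _ (hen y)). }
  rewrite hd.
  assert (hle : forall k, Rabs ((mu n k - nu k) * (p k * y ^ k)) <= 2 * u k).
  { intros k; rewrite Rabs_mult; apply Rmult_le_compat_r; [apply Rabs_pos|].
    unfold Rminus; eapply Rle_trans; [apply Rabs_triang|].
    rewrite Rabs_Ropp; specialize (hmu n k); specialize (hnu k); lra. }
  assert (h2u : ex_series (fun k => 2 * u k)) by (apply (ex_series_scal 2 u hu)).
  assert (hex : ex_series (fun k => Rabs ((mu n k - nu k) * (p k * y ^ k)))).
  { apply (@ex_series_le R_AbsRing R_CompleteNormedModule)
      with (b := fun k => 2 * u k); [|exact h2u].
    intros k; change (Rabs (Rabs ((mu n k - nu k) * (p k * y ^ k))) <= 2 * u k).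
    rewrite Rabs_Rabsolu; apply hle. }
  eapply Rle_lt_trans; [apply Series_Rabs, hex|].
  rewrite (Series_incr_n _ (S N)); [|lia|exact hex].
  simpl pred; rewrite <- sum_n_Reals.
  assert (hA : sum_n (fun k => Rabs ((mu n k - nu k) * (p k * y ^ k))) N < eps / 4).
  { eapply Rle_lt_trans; [|eapply Rle_lt_trans; [apply Rle_abs|exact hn0]].
    right; apply sum_n_ext; intros k; unfold u; rewrite Rabs_mult; reflexivity. }
  assert (hB : Series (fun k => Rabs ((mu n (S N + k)%nat - nu (S N + k)%nat)
                 * (p (S N + k)%nat * y ^ (S N + k)))) <= 2 * (eps / 4)).
  { eapply Rle_trans;
      [apply Series_le with (b := fun k => 2 * u (S N + k)%nat)|].
    - intros k; split; [apply Rabs_pos|apply (hle (S N + k)%nat)].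
    - apply (proj1 (ex_series_incr_n _ (S N)) h2u).
    - rewrite (Series_scal_l 2 (fun k => u (S N + k)%nat)).
      pose proof (Rle_abs (Series (fun k => u (S N + k)%nat))); lra. }
  pose proof (cond_pos eps); lra.
Qed.

Definition res (be : R) (p : nat -> R) (k : nat) : R := p k / (be + INR k).

Lemma res_entire be p : 0 < be -> entire p -> entire (res be p).
Proof.
  intros hbe hp; apply (entire_dominated p _ (/ be) hp); intros k.
  pose proof (pos_INR k).
  unfold res, Rdiv; rewrite Rabs_mult, Rmult_comm.
  apply Rmult_le_compat_r; [apply Rabs_pos|].
  rewrite Rabs_pos_eq; [apply Rinv_le_contravar; lra|].
  left; apply Rinv_0_lt_compat; lra.
Qed.

Lemma res_ode be p y : 0 < be -> entire p ->
  y * PSeries (PS_derive (res be p)) y + be * PSeries (res be p) y = PSeries p y.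
Proof.
  intros hbe hp.
  pose proof (res_entire be p hbe hp) as hr.
  rewrite <- PSeries_incr_1, <- PSeries_scal, <- PSeries_plus.
  - apply PSeries_ext; intros [|k].
    + change (0 + be * (p O / (be + 0)) = p O); field; lra.
    + change (INR (S k) * (p (S k) / (be + INR (S k)))
              + be * (p (S k) / (be + INR (S k))) = p (S k)).
      pose proof (pos_INR (S k)); field; lra.
  - apply ex_pseries_incr_1, entire_ex, entire_derive, hr.
  - apply ex_pseries_scal; [intros; apply Rmult_comm|apply entire_ex, hr].
Qed.

Lemma is_derive_Rpower x be :
  0 < x -> is_derive (fun t => Rpower t be) x (be * Rpower x be / x).
Proof.
  intros hx; unfold Rpower; auto_derive; [exact hx|field; lra].
Qed.

Lemma is_derive_Rpower_mult phi x be l :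
  0 < x -> is_derive phi x l ->
  is_derive (fun t => Rpower t be * phi t) x (Rpower x be / x * (x * l + be * phi x)).
Proof.
  intros hx h.
  replace (Rpower x be / x * (x * l + be * phi x))
    with (plus (mult (be * Rpower x be / x) (phi x)) (mult (Rpower x be) l)).
  - apply (is_derive_mult (fun t => Rpower t be) phi);
      [apply is_derive_Rpower, hx|exact h|intros; apply Rmult_comm].
  - change (be * Rpower x be / x * phi x + Rpower x be * l
            = Rpower x be / x * (x * l + be * phi x)); field; lra.
Qed.

Lemma Rpower_mult_mono phi dphi be s t :
  0 < s <= t ->
  (forall x, s <= x <= t -> is_derive phi x (dphi x)) ->
  (forall x, s <= x <= t -> 0 <= x * dphi x + be * phi x) ->
  Rpower s be * phi s <= Rpower t be * phi t.
Proof.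
  intros [hs hst] hd hp.
  destruct (MVT_gen (fun x => Rpower x be * phi x) s t
    (fun x => Rpower x be / x * (x * dphi x + be * phi x))) as [c [hc e]].
  - intros x; rewrite Rmin_left, Rmax_right by lra; intros hx.
    apply is_derive_Rpower_mult; [lra|apply hd; lra].
  - intros x; rewrite Rmin_left, Rmax_right by lra; intros hx.
    apply derivable_continuous_pt, ex_derive_Reals_0; eexists.
    apply is_derive_Rpower_mult; [lra|apply hd; lra].
  - rewrite Rmin_left, Rmax_right in hc by lra.
    assert (0 <= Rpower c be / c * (c * dphi c + be * phi c)).
    { apply Rmult_le_pos; [|apply hp; lra].
      unfold Rdiv; apply Rmult_le_pos; left;
        [apply exp_pos|apply Rinv_0_lt_compat; lra]. }
    nra.
Qed.

(** The weighted function [x^be * phi x] is nondecreasing, so a negative value at [y] would persist,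
    and grow in size, towards 0, against [phi 0 >= 0]. The latter is the hypothesis at [x = 0],
    where the derivative term vanishes. *)
Lemma euler_nonneg phi dphi be Y :
  0 < be ->
  (forall x, 0 <= x <= Y -> is_derive phi x (dphi x)) ->
  (forall x, 0 <= x <= Y -> 0 <= x * dphi x + be * phi x) ->
  forall y, 0 <= y <= Y -> 0 <= phi y.
Proof.
  intros hbe hd hp y hy.
  assert (h0 : 0 <= phi 0).
  { specialize (hp 0 ltac:(lra)); nra. }
  destruct (Req_dec y 0) as [->|hy0]; [exact h0|].
  destruct (Rle_lt_dec 0 (phi y)) as [h|h]; [exact h|exfalso].
  assert (hc : continuity_pt phi 0).
  { apply derivable_continuous_pt, ex_derive_Reals_0; eexists; apply hd; lra. }
  destruct (hc (- phi y) ltac:(lra)) as [al [hal hc']].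
  (* The comparison starts at some [t > 0], because [Rpower 0 be] is a default value and not the
     power of 0. *)
  set (t := Rmin (al / 2) y).
  assert (ht : 0 < t <= y).
  { unfold t; split; [apply Rmin_glb_lt; lra|apply Rmin_r]. }
  assert (htal : t < al).
  { apply Rle_lt_trans with (al / 2); [apply Rmin_l|lra]. }
  assert (hcl : R_dist (phi t) (phi 0) < - phi y).
  { apply hc'; split; [split; [exact I|lra]|].
    simpl; unfold R_dist; rewrite Rminus_0_r, Rabs_pos_eq; lra. }
  unfold R_dist in hcl; apply Rabs_def2 in hcl.
  pose proof (Rpower_mult_mono phi dphi be t y ht
    ltac:(intros; apply hd; lra) ltac:(intros; apply hp; lra)) as hm.
  assert (hpow : Rpower t be <= Rpower y be) by (apply Rle_Rpower_l; lra).
  assert (0 < Rpower t be) by apply exp_pos.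
  nra.
Qed.

Lemma res_nonneg be p Y :
  0 < be -> entire p -> (forall y, 0 <= y <= Y -> 0 <= PSeries p y) ->
  forall y, 0 <= y <= Y -> 0 <= PSeries (res be p) y.
Proof.
  intros hbe hp h.
  apply (euler_nonneg _ (PSeries (PS_derive (res be p))) be); [exact hbe| |].
  - intros; apply entire_is_derive, res_entire; auto.
  - intros; rewrite res_ode; auto.
Qed.

Lemma res_mono be p s t :
  0 < be -> entire p -> 0 < s <= t ->
  (forall y, s <= y <= t -> 0 <= PSeries p y) ->
  Rpower s be * PSeries (res be p) s <= Rpower t be * PSeries (res be p) t.
Proof.
  intros hbe hp hst h.
  apply (Rpower_mult_mono _ (PSeries (PS_derive (res be p)))); [exact hst| |].
  - intros; apply entire_is_derive, res_entire; auto.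
  - intros; rewrite res_ode; auto.
Qed.

(** The resolvent starts from [p 0 / be > 0], so it is positive at some small [t], and monotonicity
    of the weighted function carries this to every larger [y]. *)
Lemma res_pos be p Y :
  0 < be -> entire p -> 0 < p O -> (forall y, 0 <= y <= Y -> 0 <= PSeries p y) ->
  forall y, 0 <= y <= Y -> 0 < PSeries (res be p) y.
Proof.
  intros hbe hp hp0 h y hy.
  assert (h0 : 0 < PSeries (res be p) 0).
  { rewrite PSeries_0; unfold res; simpl.
    apply Rdiv_lt_0_compat; lra. }
  destruct (Req_dec y 0) as [->|hy0]; [exact h0|].
  destruct (entire_continuity _ (res_entire be p hbe hp) 0
              (PSeries (res be p) 0) h0) as [al [hal hc']].
  set (t := Rmin (al / 2) y).
  assert (ht : 0 < t <= y).
  { unfold t; split; [apply Rmin_glb_lt; lra|apply Rmin_r]. }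
  assert (htal : t < al).
  { apply Rle_lt_trans with (al / 2); [apply Rmin_l|lra]. }
  assert (hcl : R_dist (PSeries (res be p) t) (PSeries (res be p) 0)
                < PSeries (res be p) 0).
  { apply hc'; split; [split; [exact I|lra]|].
    simpl; unfold R_dist; rewrite Rminus_0_r, Rabs_pos_eq; lra. }
  unfold R_dist in hcl; apply Rabs_def2 in hcl.
  pose proof (res_mono be p t y hbe hp ht ltac:(intros; apply h; lra)) as hm.
  assert (0 < Rpower t be * PSeries (res be p) t)
    by (apply Rmult_lt_0_compat; [apply exp_pos|lra]).
  assert (0 < Rpower y be) by apply exp_pos.
  nra.
Qed.

(** A version of [y^(-a)] that stays finite at 0, so that decay can be stated on the whole half-line
    at once. *)
Definition barrier (a y : R) : R := Rpower (1 + y) (- a).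

Lemma barrier_pos a y : 0 < barrier a y.
Proof. apply exp_pos. Qed.

Lemma is_derive_barrier a y :
  0 <= y -> is_derive (barrier a) y (- a * barrier a y / (1 + y)).
Proof.
  intros hy; unfold barrier, Rpower; auto_derive; [lra|field; lra].
Qed.

(** The barrier [w] satisfies [x w' + be w = (be - a) w + a w / (1 + x) >= (be - a) w], so
    [M / (be - a) * w] dominates both [phi] and [- phi] by [euler_nonneg]. *)
Lemma euler_barrier phi dphi M a be :
  0 <= a < be ->
  (forall x, 0 <= x -> is_derive phi x (dphi x)) ->
  (forall x, 0 <= x -> Rabs (x * dphi x + be * phi x) <= M * barrier a x) ->
  forall y, 0 <= y -> Rabs (phi y) <= M / (be - a) * barrier a y.
Proof.
  intros ha hd hM y hy.
  assert (key : forall s, s = 1 \/ s = -1 ->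
            0 <= M / (be - a) * barrier a y - s * phi y).
  { intros s hs.
    apply (euler_nonneg (fun x => M / (be - a) * barrier a x - s * phi x)
      (fun x => M / (be - a) * (- a * barrier a x / (1 + x)) - s * dphi x)
      be y); try lra.
    - intros x hx.
      apply (@is_derive_minus R_AbsRing R_NormedModule
               (fun x => M / (be - a) * barrier a x) (fun x => s * phi x)).
      + apply (is_derive_scal (barrier a)), is_derive_barrier; lra.
      + apply (is_derive_scal phi), hd; lra.
    - intros x [hx _]; specialize (hM x hx); apply Rabs_le_between in hM.
      pose proof (barrier_pos a x) as hb.
      assert (hM0 : 0 <= M) by nra.
      assert (e : x * (M / (be - a) * (- a * barrier a x / (1 + x)) - s * dphi x)
         + be * (M / (be - a) * barrier a x - s * phi x)
         = M * barrier a x + M * barrier a x * (a / ((be - a) * (1 + x)))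
           - s * (x * dphi x + be * phi x)) by (field; lra).
      rewrite e.
      assert (0 <= M * barrier a x * (a / ((be - a) * (1 + x)))).
      { apply Rmult_le_pos; [nra|].
        apply Rmult_le_pos; [lra|left; apply Rinv_0_lt_compat; nra]. }
      destruct hs; subst s; lra. }
  pose proof (key 1 (or_introl eq_refl)); pose proof (key (-1) (or_intror eq_refl)).
  apply Rabs_le_between; lra.
Qed.

Lemma res_barrier M a be p :
  0 <= a < be -> entire p ->
  (forall y, 0 <= y -> Rabs (PSeries p y) <= M * barrier a y) ->
  forall y, 0 <= y -> Rabs (PSeries (res be p) y) <= M / (be - a) * barrier a y.
Proof.
  intros ha hp h.
  apply (euler_barrier _ (PSeries (PS_derive (res be p)))); [exact ha| |].
  - intros; apply entire_is_derive, res_entire; auto; lra.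
  - intros; rewrite res_ode; auto; lra.
Qed.

(* At the critical exponent the resolvent still maps decay of order [a + 1] to
   decay of order [a], because [x w' + a w = a (1 + x)^(-a-1)] for [w = (1 + x)^(-a)]. *)
Lemma res_barrier_critical M a p :
  0 < a -> entire p ->
  (forall y, 0 <= y -> Rabs (PSeries p y) <= M * barrier (a + 1) y) ->
  forall y, 0 <= y -> Rabs (PSeries (res a p) y) <= M / a * barrier a y.
Proof.
  intros ha hp h y hy.
  assert (hr : entire (res a p)) by (apply res_entire; auto).
  assert (key : forall s, s = 1 \/ s = -1 ->
            0 <= M / a * barrier a y - s * PSeries (res a p) y).
  { intros s hs.
    apply (euler_nonneg (fun x => M / a * barrier a x - s * PSeries (res a p) x)
      (fun x => M / a * (- a * barrier a x / (1 + x))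
                - s * PSeries (PS_derive (res a p)) x) a y); try lra.
    - intros x hx.
      apply (@is_derive_minus R_AbsRing R_NormedModule
               (fun x => M / a * barrier a x) (fun x => s * PSeries (res a p) x)).
      + apply (is_derive_scal (barrier a)), is_derive_barrier; lra.
      + apply (is_derive_scal (PSeries (res a p))), entire_is_derive, hr.
    - intros x [hx _]; specialize (h x hx); apply Rabs_le_between in h.
      rewrite <- (res_ode a p x ha hp) in h.
      assert (hb : barrier (a + 1) x = barrier a x / (1 + x)).
      { unfold barrier; rewrite Ropp_plus_distr, Rpower_plus, (Rpower_Ropp _ 1),
          Rpower_1 by lra; reflexivity. }
      rewrite hb in h.
      assert (e : x * (M / a * (- a * barrier a x / (1 + x))
                       - s * PSeries (PS_derive (res a p)) x)
         + a * (M / a * barrier a x - s * PSeries (res a p) x)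
         = M * (barrier a x / (1 + x))
           - s * (x * PSeries (PS_derive (res a p)) x + a * PSeries (res a p) x))
        by (field; lra).
      rewrite e; destruct hs; subst s; lra. }
  pose proof (key 1 (or_introl eq_refl)); pose proof (key (-1) (or_intror eq_refl)).
  apply Rabs_le_between; lra.
Qed.

(** * The multipliers (A)_k / (B)_k *)

Lemma poch_pos s k : 0 < s -> 0 < poch s k.
Proof.
  intros hs; induction k as [|k IH]; simpl; [lra|].
  pose proof (pos_INR k); apply Rmult_lt_0_compat; lra.
Qed.

Lemma poch_add s n k : poch s (n + k) = poch s n * poch (s + INR n) k.
Proof.
  induction k as [|k IH]; simpl; [rewrite Nat.add_0_r; ring|].
  rewrite Nat.add_succ_r; simpl; rewrite IH, plus_INR; ring.
Qed.

Lemma poch_shift s k : 0 < s -> poch (s + 1) k = poch s k * (s + INR k) / s.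
Proof.
  intros hs; pose proof (poch_add s 1 k) as h; simpl in h.
  rewrite Rplus_0_r, Rmult_1_l in h; field_simplify_eq; [|lra].
  rewrite Rmult_comm, <- h; ring.
Qed.

Lemma res_ext be p q k : (forall j, p j = q j) -> res be p k = res be q k.
Proof. intros h; unfold res; rewrite h; reflexivity. Qed.

Definition beta (A B : R) (p : nat -> R) (k : nat) : R := poch A k / poch B k * p k.

(** The factors from index [n] on form the same ratio with [A] and [B] shifted by [n]; dividing them
    out gives the product of the first [n] factors in closed form. *)
Definition beta_mult (A B : R) (n k : nat) : R :=
  poch A k / poch B k * (poch (B + INR n) k / poch (A + INR n) k).

(* The partial products of the factorization
   (A)_k / (B)_k = prod_n (A + n) / (B + n) * (1 + (B - A) / (A + n + k)). *)
Definition beta_part (A B : R) (p : nat -> R) (n k : nat) : R := beta_mult A B n k * p k.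

Lemma beta_mult_pos A B n k : 0 < A -> 0 < B -> 0 < beta_mult A B n k.
Proof.
  intros hA hB; pose proof (pos_INR n); unfold beta_mult.
  apply Rmult_lt_0_compat; apply Rdiv_lt_0_compat; apply poch_pos; lra.
Qed.

Lemma beta_mult_le A B n k : 0 < A <= B -> beta_mult A B n k <= 1.
Proof.
  intros hAB; pose proof (pos_INR n) as hn; unfold beta_mult.
  induction k as [|k IH]; simpl; [lra|].
  pose proof (pos_INR k) as hk.
  pose proof (poch_pos A k ltac:(lra)); pose proof (poch_pos B k ltac:(lra)).
  pose proof (poch_pos (A + INR n) k ltac:(lra)).
  pose proof (poch_pos (B + INR n) k ltac:(lra)).
  replace (poch A k * (A + INR k) / (poch B k * (B + INR k)) *
     (poch (B + INR n) k * (B + INR n + INR k) / (poch (A + INR n) k * (A + INR n + INR k))))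
    with (poch A k / poch B k * (poch (B + INR n) k / poch (A + INR n) k)
          * ((A + INR k) * (B + INR n + INR k) / ((B + INR k) * (A + INR n + INR k))))
    by (field; repeat split; lra).
  assert (h : (A + INR k) * (B + INR n + INR k) / ((B + INR k) * (A + INR n + INR k)) <= 1).
  { apply Rle_div_l; [apply Rmult_lt_0_compat; lra|nra]. }
  assert (0 <= poch A k / poch B k * (poch (B + INR n) k / poch (A + INR n) k)).
  { apply Rmult_le_pos; left; apply Rdiv_lt_0_compat; assumption. }
  assert (0 <= (A + INR k) * (B + INR n + INR k) / ((B + INR k) * (A + INR n + INR k))).
  { left; apply Rdiv_lt_0_compat; apply Rmult_lt_0_compat; lra. }
  nra.
Qed.

Lemma beta_mult_abs A B n k : 0 < A <= B -> Rabs (beta_mult A B n k) <= 1.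
Proof.
  intros h; rewrite Rabs_pos_eq; [apply beta_mult_le, h|].
  left; apply beta_mult_pos; lra.
Qed.

Lemma is_lim_seq_INR_ratio u v :
  is_lim_seq (fun n => (u + INR n) / (v + INR n)) 1.
Proof.
  assert (hv : is_lim_seq (fun n => v + INR n) p_infty).
  { apply (is_lim_seq_plus (fun _ => v) INR v p_infty);
      [apply is_lim_seq_const|apply is_lim_seq_INR|reflexivity]. }
  apply is_lim_seq_ext_loc with (fun n => 1 + (u - v) * / (v + INR n)).
  - apply is_lim_seq_spec in hv; destruct (hv 0) as [N hN].
    exists N; intros n hn; specialize (hN n hn); simpl in hN; field; lra.
  - replace (Finite 1) with (Finite (1 + (u - v) * 0)) by (f_equal; ring).
    apply is_lim_seq_plus'; [apply is_lim_seq_const|].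
    apply (is_lim_seq_scal_l _ (u - v) 0).
    apply (is_lim_seq_inv _ p_infty hv); discriminate.
Qed.

Lemma beta_mult_lim A B k :
  is_lim_seq (fun n => beta_mult A B n k) (poch A k / poch B k).
Proof.
  unfold beta_mult.
  replace (Finite (poch A k / poch B k)) with (Rbar_mult (poch A k / poch B k) 1)
    by (simpl; f_equal; ring).
  apply is_lim_seq_scal_l.
  induction k as [|k IH]; simpl.
  - apply is_lim_seq_ext with (fun _ => 1); [intros; field|apply is_lim_seq_const].
  - apply is_lim_seq_ext with (fun n => poch (B + INR n) k / poch (A + INR n) k
      * ((B + INR k + INR n) / (A + INR k + INR n))).
    + intros n; unfold Rdiv; rewrite Rinv_mult.
      replace (B + INR n + INR k) with (B + INR k + INR n) by ring.
      replace (A + INR n + INR k) with (A + INR k + INR n) by ring; ring.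
    + replace (Finite 1) with (Finite (1 * 1)) by (f_equal; ring).
      apply is_lim_seq_mult'; [exact IH|apply is_lim_seq_INR_ratio].
Qed.

Lemma beta_part_entire A B p n :
  0 < A <= B -> entire p -> entire (beta_part A B p n).
Proof.
  intros h hp; apply (entire_dominated p _ 1 hp); intros k.
  unfold beta_part; rewrite Rabs_mult.
  apply Rmult_le_compat_r; [apply Rabs_pos|apply beta_mult_abs, h].
Qed.

Lemma beta_part_0 A B p k : 0 < A -> 0 < B -> beta_part A B p 0 k = p k.
Proof.
  intros hA hB; unfold beta_part, beta_mult; simpl; rewrite !Rplus_0_r.
  pose proof (poch_pos A k hA); pose proof (poch_pos B k hB); field; lra.
Qed.

Lemma beta_part_S A B p n k : 0 < A -> 0 < B ->
  beta_part A B p (S n) k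
  = (A + INR n) / (B + INR n) * beta_part A B p n k
    + (A + INR n) / (B + INR n) * (B - A) * res (A + INR n) (beta_part A B p n) k.
Proof.
  intros hA hB; pose proof (pos_INR n); pose proof (pos_INR k).
  unfold beta_part, beta_mult, res.
  rewrite S_INR, <- !Rplus_assoc, !poch_shift by lra.
  pose proof (poch_pos B k ltac:(lra)).
  pose proof (poch_pos (A + INR n) k ltac:(lra)).
  field; repeat split; lra.
Qed.

Lemma PSeries_beta_part_S A B p n y : 0 < A <= B -> entire p ->
  PSeries (beta_part A B p (S n)) y
  = (A + INR n) / (B + INR n) *
    (PSeries (beta_part A B p n) y
     + (B - A) * PSeries (res (A + INR n) (beta_part A B p n)) y).
Proof.
  intros h hp; pose proof (pos_INR n).
  rewrite (PSeries_ext _ _ y (fun k => beta_part_S A B p n k ltac:(lra) ltac:(lra))).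
  rewrite PSeries_lin; [ring| |apply res_entire; [lra|]]; apply beta_part_entire; auto.
Qed.

Lemma beta_part_lim A B p y : 0 < A <= B -> entire p ->
  is_lim_seq (fun n => PSeries (beta_part A B p n) y) (PSeries (beta A B p) y).
Proof.
  intros h hp; apply (PSeries_multiplier_lim p (beta_mult A B)); [exact hp| |].
  - intros; apply beta_mult_abs, h.
  - apply beta_mult_lim.
Qed.

Lemma beta_entire A B p : 0 < A <= B -> entire p -> entire (beta A B p).
Proof.
  intros h hp; apply (entire_dominated p _ 1 hp); intros k.
  unfold beta; rewrite Rabs_mult; apply Rmult_le_compat_r; [apply Rabs_pos|].
  apply (is_lim_seq_le (fun n => Rabs (beta_mult A B n k)) (fun _ => 1)
           (Rabs (poch A k / poch B k)) 1).
  - intros; apply beta_mult_abs, h.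
  - apply (is_lim_seq_abs _ (poch A k / poch B k)), beta_mult_lim.
  - apply is_lim_seq_const.
Qed.

Lemma beta_part_nonneg A B p Y n :
  0 < A <= B -> entire p -> (forall y, 0 <= y <= Y -> 0 <= PSeries p y) ->
  forall y, 0 <= y <= Y -> 0 <= PSeries (beta_part A B p n) y.
Proof.
  intros hAB hp h; induction n as [|n IH]; intros y hy.
  - rewrite (PSeries_ext _ p); [auto|intros; apply beta_part_0; lra].
  - rewrite PSeries_beta_part_S by auto; pose proof (pos_INR n).
    apply Rmult_le_pos; [left; apply Rdiv_lt_0_compat; lra|].
    apply Rplus_le_le_0_compat; [auto|apply Rmult_le_pos; [lra|]].
    apply (res_nonneg _ _ Y); auto; [lra|apply beta_part_entire; auto].
Qed.

Lemma beta_nonneg A B p Y :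
  0 < A <= B -> entire p -> (forall y, 0 <= y <= Y -> 0 <= PSeries p y) ->
  forall y, 0 <= y <= Y -> 0 <= PSeries (beta A B p) y.
Proof.
  intros hAB hp h y hy.
  apply (is_lim_seq_le (fun _ => 0) (fun n => PSeries (beta_part A B p n) y)
           0 (PSeries (beta A B p) y)).
  - intros n; apply (beta_part_nonneg A B p Y); auto.
  - apply is_lim_seq_const.
  - apply beta_part_lim; auto.
Qed.

Definition sub_const (p : nat -> R) (de : R) (k : nat) : R :=
  match k with O => p O - de | S _ => p k end.

Lemma sub_const_lin p de k :
  sub_const p de k = 1 * p k + (- de) * (match k with O => 1 | S _ => 0 end).
Proof. destruct k; simpl; ring. Qed.

Lemma is_series_one y :
  is_series (fun k => (match k with O => 1 | S _ => 0 end) * y ^ k) 1.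
Proof.
  apply (filterlim_ext (fun _ => 1)); [|apply filterlim_const].
  intros n; induction n as [|n IH]; [rewrite sum_O; simpl; ring|].
  rewrite sum_Sn, <- IH; change (1 = 1 + 0 * y ^ S n); ring.
Qed.

Lemma entire_one : entire (fun k => match k with O => 1 | S _ => 0 end).
Proof.
  intros y; exists 1.
  apply (is_series_ext (fun k => (match k with O => 1 | S _ => 0 end) * y ^ k));
    [|apply is_series_one].
  intros [|k]; [simpl; rewrite Rmult_1_r, Rabs_R1; reflexivity|].
  rewrite !Rmult_0_l, Rabs_R0; reflexivity.
Qed.

Lemma sub_const_entire p de : entire p -> entire (sub_const p de).
Proof.
  intros hp; apply (entire_dominated _ _ 1 (entire_lin _ _ 1 (- de) hp entire_one)).
  intros k; rewrite sub_const_lin; lra.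
Qed.

Lemma PSeries_sub_const p de y : entire p ->
  PSeries (sub_const p de) y = PSeries p y - de.
Proof.
  intros hp; rewrite (PSeries_ext _ _ y (sub_const_lin p de)).
  rewrite PSeries_lin; [|exact hp|apply entire_one].
  assert (e : PSeries (fun k => match k with O => 1 | S _ => 0 end) y = 1)
    by (apply is_series_unique, is_series_one).
  rewrite e; ring.
Qed.

(** Index 0 has multiplier 1, so constants pass through [beta] unchanged. Subtracting the positive
    minimum on [[0, Y]] reduces strict positivity to [beta_nonneg]. *)
Lemma beta_pos A B p Y :
  0 < A <= B -> entire p -> (forall y, 0 <= y <= Y -> 0 < PSeries p y) ->
  forall y, 0 <= y <= Y -> 0 < PSeries (beta A B p) y.
Proof.
  intros hAB hp h y hy.
  destruct (continuity_ab_min (PSeries p) 0 Y ltac:(lra)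
             (fun c _ => entire_continuity p hp c)) as [m [hm hmY]].
  set (de := PSeries p m).
  assert (hde : 0 < de) by (apply h; lra).
  assert (hle : 0 <= PSeries (beta A B (sub_const p de)) y).
  { apply (beta_nonneg A B _ Y); auto; [apply sub_const_entire, hp|].
    intros z hz; rewrite PSeries_sub_const by exact hp; specialize (hm z hz).
    fold de in hm; lra. }
  rewrite (PSeries_ext _ (sub_const (beta A B p) de)) in hle.
  - rewrite PSeries_sub_const in hle by (apply beta_entire; auto); lra.
  - intros [|k]; unfold beta, sub_const; simpl; [field|reflexivity].
Qed.

(* Strictness comes from the first factor of the product. *)
Lemma beta_strict A B p Y :
  0 < A < B -> entire p -> 0 < p O -> (forall y, 0 <= y <= Y -> 0 <= PSeries p y) ->
  forall y, 0 <= y <= Y -> 0 < PSeries (beta A B p) y.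
Proof.
  intros hAB hp hp0 h y hy.
  (* Splitting off the factor of index 0 leaves the multiplier with both parameters raised by 1. The
     split factor contributes [res A p], which is positive even where the series of [p] vanishes. *)
  rewrite (PSeries_ext _ (beta (A + 1) (B + 1) (beta_part A B p 1))).
  - apply (beta_pos _ _ _ Y); [lra|apply beta_part_entire; auto; lra| |exact hy].
    intros z hz; rewrite PSeries_beta_part_S by (auto; lra); simpl.
    rewrite !Rplus_0_r.
    rewrite (PSeries_ext (beta_part A B p 0) p) by (intros; apply beta_part_0; lra).
    rewrite (PSeries_ext (res A (beta_part A B p 0)) (res A p))
      by (intros; apply res_ext; intros; apply beta_part_0; lra).
    pose proof (res_pos A p Y ltac:(lra) hp hp0 h z hz); specialize (h z hz).
    apply Rmult_lt_0_compat; [apply Rdiv_lt_0_compat; lra|nra].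
  - intros k; unfold beta, beta_part, beta_mult; simpl.
    pose proof (pos_INR k).
    pose proof (poch_pos A k ltac:(lra)); pose proof (poch_pos B k ltac:(lra)).
    pose proof (poch_pos (A + 1) k ltac:(lra)); pose proof (poch_pos (B + 1) k ltac:(lra)).
    field; repeat split; lra.
Qed.

(** Since [1 + x <= exp x], the exponents add up, and [1 / ((n + 1) (n + 2))] telescopes: the
    induction carries the exact partial sum [1 - 1 / (n + 1)]. *)
Lemma prod_bound (u : nat -> R) K : 0 <= K -> 0 <= u O ->
  (forall n, 0 <= u n ->
     0 <= u (S n) <= u n * (1 + K / (INR (S n) * INR (S (S n))))) ->
  forall n, 0 <= u n <= u O * exp K.
Proof.
  intros hK h0 h n.
  assert (key : 0 <= u n <= u O * exp (K * (1 - / INR (S n)))).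
  { induction n as [|n IH].
    - simpl; rewrite Rinv_1, Rminus_diag, Rmult_0_r, exp_0; lra.
    - destruct (h n (proj1 IH)) as [h1 h2]; split; [exact h1|].
      pose proof (lt_0_INR (S n) ltac:(lia)) as hn1.
      pose proof (lt_0_INR (S (S n)) ltac:(lia)) as hn2.
      replace (K * (1 - / INR (S (S n))))
        with (K * (1 - / INR (S n)) + K / (INR (S n) * INR (S (S n)))).
      2: { rewrite (S_INR (S n)) in *; field; lra. }
      rewrite exp_plus, <- Rmult_assoc.
      assert (hx : 0 <= K / (INR (S n) * INR (S (S n)))).
      { apply Rmult_le_pos; [exact hK|left; apply Rinv_0_lt_compat; nra]. }
      eapply Rle_trans; [exact h2|apply Rmult_le_compat; try lra].
      pose proof (exp_ineq1_le (K / (INR (S n) * INR (S (S n))))); lra. }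
  split; [lra|]; eapply Rle_trans; [apply key|].
  apply Rmult_le_compat_l; [exact h0|].
  assert (0 < / INR (S n)) by (apply Rinv_0_lt_compat, lt_0_INR; lia).
  assert (he : K * (1 - / INR (S n)) <= K) by nra.
  destruct he as [he|he]; [left; apply exp_increasing, he|rewrite he; lra].
Qed.

(** Brings a quadratic denominator to the telescoping form of [prod_bound]. The constants come from
    [(1 + 1/u) (u + n) >= n + 1] and [(1 + 2/v) (v + n) >= n + 2]. *)
Lemma inv_quadratic_le u v n : 0 < u -> 0 < v ->
  / ((u + INR n) * (v + INR n))
  <= ((1 + / u) * (1 + 2 / v)) / (INR (S n) * INR (S (S n))).
Proof.
  intros hu hv; pose proof (pos_INR n) as hn.
  rewrite !S_INR.
  assert (h1 : INR n + 1 <= (1 + / u) * (u + INR n)).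
  { replace ((1 + / u) * (u + INR n)) with (u + INR n + 1 + INR n * / u) by (field; lra).
    assert (0 < / u) by (apply Rinv_0_lt_compat, hu); nra. }
  assert (h2 : INR n + 1 + 1 <= (1 + 2 / v) * (v + INR n)).
  { replace ((1 + 2 / v) * (v + INR n)) with (v + INR n + 2 + 2 * (INR n * / v))
      by (field; lra).
    assert (0 < / v) by (apply Rinv_0_lt_compat, hv); nra. }
  assert (h3 : (INR n + 1) * (INR n + 1 + 1)
               <= (1 + / u) * (1 + 2 / v) * ((u + INR n) * (v + INR n))).
  { replace ((1 + / u) * (1 + 2 / v) * ((u + INR n) * (v + INR n)))
      with (((1 + / u) * (u + INR n)) * ((1 + 2 / v) * (v + INR n))) by ring.
    apply Rmult_le_compat; lra. }
  apply Rle_div_r; [nra|].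
  apply (Rmult_le_reg_l ((u + INR n) * (v + INR n))); [nra|].
  rewrite <- Rmult_assoc, Rinv_r, Rmult_1_l; nra.
Qed.

Lemma inv_quadratic_const_pos u v : 0 < u -> 0 < v -> 0 <= (1 + / u) * (1 + 2 / v).
Proof.
  intros hu hv; assert (0 < / u) by (apply Rinv_0_lt_compat, hu).
  assert (0 < 2 / v) by (apply Rdiv_lt_0_compat; lra); nra.
Qed.

(** By [res_barrier] the factor of index [n] enlarges the constant by [(A + n) / (B + n) * (1 + (B -
    A) / (A + n - a))], which equals [1 + a (B - A) / ((B + n) (A + n - a))]; the product of these
    converges. *)
Lemma beta_barrier a A B :
  0 <= a < A -> A <= B -> exists K, 0 <= K /\ forall M p, 0 <= M -> entire p ->
  (forall y, 0 <= y -> Rabs (PSeries p y) <= M * barrier a y) ->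
  forall y, 0 <= y -> Rabs (PSeries (beta A B p) y) <= M * K * barrier a y.
Proof.
  intros ha hAB.
  set (K := a * (B - A) * ((1 + / B) * (1 + 2 / (A - a)))).
  assert (hK : 0 <= K).
  { unfold K; apply Rmult_le_pos; [nra|apply inv_quadratic_const_pos; lra]. }
  exists (exp K); split; [left; apply exp_pos|]; intros M p hM hp h y hy.
  set (u := fix u n := match n with
    | O => M
    | S n => (A + INR n) / (B + INR n) * (u n + (B - A) * (u n / (A + INR n - a))) end).
  assert (hu : forall n, 0 <= u n <= M * exp K).
  { change M with (u O) at 1; apply prod_bound; [exact hK|exact hM|].
    intros n hn; pose proof (pos_INR n) as hi.
    pose proof (inv_quadratic_le B (A - a) n ltac:(lra) ltac:(lra)) as hq.
    assert (e : u (S n) = u n * (1 + a * (B - A) * / ((B + INR n) * (A - a + INR n)))).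
    { simpl; field; lra. }
    assert (0 < / ((B + INR n) * (A - a + INR n))) by (apply Rinv_0_lt_compat; nra).
    assert (0 <= a * (B - A)) by nra.
    rewrite e; split; [apply Rmult_le_pos; [exact hn|nra]|].
    apply Rmult_le_compat_l; [exact hn|apply Rplus_le_compat_l].
    apply Rle_trans with (a * (B - A) * (((1 + / B) * (1 + 2 / (A - a)))
                                         / (INR (S n) * INR (S (S n))))).
    - apply Rmult_le_compat_l; assumption.
    - right; unfold K, Rdiv; ring. }
  assert (hpart : forall n y, 0 <= y ->
            Rabs (PSeries (beta_part A B p n) y) <= u n * barrier a y).
  { induction n as [|n IH]; intros z hz.
    - rewrite (PSeries_ext _ p); [apply h, hz|intros; apply beta_part_0; lra].
    - rewrite PSeries_beta_part_S by (auto; lra); pose proof (pos_INR n) as hi.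
      rewrite Rabs_mult, Rabs_pos_eq by (left; apply Rdiv_lt_0_compat; lra).
      simpl u; rewrite Rmult_assoc.
      apply Rmult_le_compat_l; [left; apply Rdiv_lt_0_compat; lra|].
      eapply Rle_trans; [apply Rabs_triang|].
      rewrite Rabs_mult, (Rabs_pos_eq (B - A)) by lra.
      rewrite Rmult_plus_distr_r, (Rmult_assoc (B - A)).
      apply Rplus_le_compat; [apply IH, hz|apply Rmult_le_compat_l; [lra|]].
      apply (res_barrier (u n) a); auto; [lra|apply beta_part_entire; auto; lra]. }
  apply (is_lim_seq_le (fun n => Rabs (PSeries (beta_part A B p n) y))
    (fun _ => M * exp K * barrier a y)
    (Rabs (PSeries (beta A B p) y)) (M * exp K * barrier a y)).
  - intros n; eapply Rle_trans; [apply hpart, hy|].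
    apply Rmult_le_compat_r; [left; apply barrier_pos|apply hu].
  - apply (is_lim_seq_abs _ (PSeries (beta A B p) y)), beta_part_lim; auto; lra.
  - apply is_lim_seq_const.
Qed.

(** * Bessel functions: decay and oscillation *)

Definition hyp (a b c : R) (k : nat) : R :=
  (-1) ^ k * poch a k / (INR (Factorial.fact k) * poch b k * poch c k).

Definition bes (d : R) (k : nat) : R := (-1) ^ k / (INR (Factorial.fact k) * poch d k).

Lemma hyp_entire a b c : 0 < a -> 0 < b -> 0 < c -> entire (hyp a b c).
Proof.
  intros ha hb hc; apply CV_radius_entire, CV_radius_infinite_DAlembert.
  - intros k; unfold hyp, Rdiv.
    pose proof (poch_pos a k ha); pose proof (poch_pos b k hb); pose proof (poch_pos c k hc).
    pose proof (INR_fact_lt_0 k).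
    apply Rmult_integral_contrapositive_currified;
      [apply Rmult_integral_contrapositive_currified; [apply pow_nonzero; lra|lra]|].
    apply Rinv_neq_0_compat.
    apply Rmult_integral_contrapositive_currified; [|lra].
    apply Rmult_integral_contrapositive_currified; lra.
  - apply is_lim_seq_ext with
      (fun k => (a + INR k) / (b + INR k) * (/ (INR k + 1) * / (c + INR k))).
    + intros k; unfold hyp; simpl poch; rewrite fact_simpl, mult_INR, S_INR.
      pose proof (poch_pos a k ha); pose proof (poch_pos b k hb); pose proof (poch_pos c k hc).
      pose proof (INR_fact_lt_0 k); pose proof (pos_INR k).
      assert (hp : (-1) ^ k <> 0) by (apply pow_nonzero; lra).
      replace ((-1) ^ S k * (poch a k * (a + INR k)) /
        ((INR k + 1) * INR (Factorial.fact k) * (poch b k * (b + INR k)) *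
         (poch c k * (c + INR k))) /
        ((-1) ^ k * poch a k / (INR (Factorial.fact k) * poch b k * poch c k)))
        with (- ((a + INR k) / (b + INR k) * (/ (INR k + 1) * / (c + INR k))))
        by (simpl; field; repeat split; lra).
      rewrite Rabs_Ropp, Rabs_pos_eq; [reflexivity|].
      apply Rmult_le_pos; [left; apply Rdiv_lt_0_compat; lra|].
      apply Rmult_le_pos; left; apply Rinv_0_lt_compat; lra.
    + replace (Finite 0) with (Finite (1 * (0 * 0))) by (f_equal; ring).
      assert (hi : forall v, is_lim_seq (fun k => / (v + INR k)) 0).
      { intros v; apply (is_lim_seq_inv _ p_infty); [|discriminate].
        apply (is_lim_seq_plus (fun _ => v) INR v p_infty);
          [apply is_lim_seq_const|apply is_lim_seq_INR|reflexivity]. }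
      apply is_lim_seq_mult'; [apply is_lim_seq_INR_ratio|].
      apply is_lim_seq_mult'; [|apply hi].
      apply (is_lim_seq_ext (fun k => / (1 + INR k))); [|apply hi].
      intros; rewrite Rplus_comm; reflexivity.
Qed.

Lemma beta_hyp_bes a b c k : 0 < a -> 0 < b -> 0 < c ->
  beta b a (hyp a b c) k = bes c k.
Proof.
  intros ha hb hc; unfold beta, hyp, bes.
  pose proof (poch_pos a k ha); pose proof (poch_pos b k hb); pose proof (poch_pos c k hc).
  pose proof (INR_fact_lt_0 k); field; repeat split; lra.
Qed.

Lemma bes_entire d : 0 < d -> entire (bes d).
Proof.
  (* With all three parameters equal to [d], the coefficients [hyp] are those of [bes d]. *)
  intros hd; apply (entire_dominated (hyp d d d) _ 1); [apply hyp_entire; exact hd|].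
  intros k; rewrite <- (beta_hyp_bes d d d k hd hd hd); unfold beta.
  pose proof (poch_pos d k hd).
  replace (poch d k / poch d k * hyp d d d k) with (hyp d d d k) by (field; lra); lra.
Qed.

Definition J (d y : R) : R := PSeries (bes d) y.

Lemma J_0 d : J d 0 = 1.
Proof. unfold J; rewrite PSeries_0; unfold bes; simpl; field. Qed.

Lemma is_derive_J d y : 0 < d -> is_derive (J d) y (- / d * J (d + 1) y).
Proof.
  intros hd.
  replace (- / d * J (d + 1) y) with (PSeries (PS_derive (bes d)) y).
  - apply entire_is_derive, bes_entire, hd.
  - unfold J; rewrite <- PSeries_scal; apply PSeries_ext; intros k.
    change (INR (S k) * bes d (S k) = - / d * bes (d + 1) k); unfold bes.
    rewrite poch_shift by lra; rewrite fact_simpl, mult_INR.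
    pose proof (poch_pos d k hd); pose proof (INR_fact_lt_0 k); pose proof (pos_INR k).
    pose proof (lt_0_INR (S k) ltac:(lia)).
    simpl poch; simpl pow; field; repeat split; lra.
Qed.

Lemma continuity_J d : 0 < d -> continuity (J d).
Proof. intros hd; apply entire_continuity, bes_entire, hd. Qed.

Lemma J_rec d y : 0 < d ->
  y * J (d + 2) y = d * (d + 1) * (J (d + 1) y - J d y).
Proof.
  intros hd; unfold J.
  replace (d * (d + 1) * (PSeries (bes (d + 1)) y - PSeries (bes d) y))
    with (d * (d + 1) * PSeries (bes (d + 1)) y + - (d * (d + 1)) * PSeries (bes d) y)
    by ring.
  rewrite <- PSeries_lin by (apply bes_entire; lra).
  rewrite <- PSeries_incr_1; apply PSeries_ext; intros [|k].
  - change (0 = d * (d + 1) * bes (d + 1) 0 + - (d * (d + 1)) * bes d 0).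
    unfold bes; simpl; field.
  - change (bes (d + 2) k = d * (d + 1) * bes (d + 1) (S k)
                            + - (d * (d + 1)) * bes d (S k)); unfold bes.
    replace (d + 2) with (d + 1 + 1) by ring.
    rewrite !poch_shift by lra; rewrite fact_simpl, mult_INR.
    pose proof (poch_pos d k hd); pose proof (INR_fact_lt_0 k); pose proof (pos_INR k).
    rewrite S_INR; simpl poch; simpl pow; field; repeat split; lra.
Qed.

(** From [y J'' + d J' + J = 0], the function [V = J^2 + y J'^2] has derivative
    [(1 - 2 d) J'^2 <= 0] and starts from 1. At the threshold [d = 1/2], where [J] is
    [cos (2 sqrt y)], it is constant. *)
Lemma J_le_1 d y : / 2 <= d -> 0 <= y -> Rabs (J d y) <= 1.
Proof.
  intros hd hy.
  set (V := fun t => J d t * J d t + t * (- / d * J (d + 1) t) * (- / d * J (d + 1) t)).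
  assert (hV : forall t, 0 <= t ->
            is_derive V t ((1 - 2 * d) * (- / d * J (d + 1) t) ^ 2)).
  { intros t ht; unfold V.
    pose proof (is_derive_J d t ltac:(lra)) as h0.
    pose proof (is_derive_J (d + 1) t ltac:(lra)) as h1.
    pose proof (J_rec d t ltac:(lra)) as hr.
    auto_derive.
    - repeat split; try (eexists; eassumption).
    - rewrite (is_derive_unique (fun x : R => J d x) _ _ h0).
      rewrite (is_derive_unique (fun x : R => J (d + 1) x) _ _ h1).
      replace (d + 1 + 1) with (d + 2) by ring.
      assert (e : J d t = J (d + 1) t - t * J (d + 2) t / (d * (d + 1)))
        by (rewrite hr; field; lra).
      rewrite e; field; lra. }
  destruct (MVT_gen V 0 y (fun t => (1 - 2 * d) * (- / d * J (d + 1) t) ^ 2))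
    as [c [hc e]].
  - intros x; rewrite Rmin_left, Rmax_right by lra; intros hx; apply hV; lra.
  - intros x; rewrite Rmin_left, Rmax_right by lra; intros hx.
    apply derivable_continuous_pt, ex_derive_Reals_0; eexists; apply hV; lra.
  - assert (V 0 = 1) by (unfold V; rewrite J_0; ring).
    assert (0 <= (2 * d - 1) * (- / d * J (d + 1) c) ^ 2 * y).
    { apply Rmult_le_pos; [apply Rmult_le_pos; [lra|apply pow2_ge_0]|exact hy]. }
    assert (0 <= y * (- / d * J (d + 1) y) ^ 2)
      by (apply Rmult_le_pos; [exact hy|apply pow2_ge_0]).
    assert (J d y * J d y <= 1) by (unfold V in *; nra).
    apply Rabs_le_between; nra.
Qed.

(** Each use of [J_rec] trades two units of the parameter for one power of [y]. The rate is cruder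
    than the true one, but it exceeds any given power once [d] is large. *)
Lemma J_decay N : forall d, / 2 + 2 * INR N <= d ->
  exists K, 0 <= K /\ forall y, 0 <= y -> Rabs (J d y) <= K / (1 + y) ^ N.
Proof.
  induction N as [|N IH]; intros d hd.
  - exists 1; split; [lra|]; intros y hy; simpl in *.
    rewrite Rdiv_1_r; apply J_le_1; lra.
  - rewrite S_INR in hd; pose proof (pos_INR N) as hN.
    set (e := d - 2); assert (hde : d = e + 2) by (unfold e; ring).
    destruct (IH e ltac:(lra)) as [K0 [hK0 h0]].
    destruct (IH (e + 1) ltac:(lra)) as [K1 [hK1 h1]].
    destruct (IH d ltac:(lra)) as [K2 [hK2 h2]].
    assert (hee : 0 <= e * (e + 1)) by nra.
    exists (K2 + e * (e + 1) * (K1 + K0)); split; [nra|]; intros y hy.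
    specialize (h0 y hy); specialize (h1 y hy); specialize (h2 y hy).
    assert (hp : 0 < (1 + y) ^ N) by (apply pow_lt; lra).
    pose proof (J_rec e y ltac:(lra)) as hr; rewrite <- hde in hr.
    assert (hy2 : y * Rabs (J d y) <= e * (e + 1) * ((K1 + K0) / (1 + y) ^ N)).
    { rewrite <- (Rabs_pos_eq y) at 1 by exact hy.
      rewrite <- Rabs_mult, hr, Rabs_mult, (Rabs_pos_eq (e * (e + 1))) by exact hee.
      apply Rmult_le_compat_l; [exact hee|].
      unfold Rminus; eapply Rle_trans; [apply Rabs_triang|]; rewrite Rabs_Ropp.
      unfold Rdiv in *; lra. }
    simpl pow; apply Rle_div_r; [apply Rmult_lt_0_compat; lra|].
    apply Rle_trans with ((1 + y) ^ N * (K2 / (1 + y) ^ N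
                          + e * (e + 1) * ((K1 + K0) / (1 + y) ^ N))).
    + replace (Rabs (J d y) * ((1 + y) * (1 + y) ^ N))
        with ((1 + y) ^ N * (Rabs (J d y) + y * Rabs (J d y))) by ring.
      apply Rmult_le_compat_l; lra.
    + right; field; lra.
Qed.

Lemma J_barrier a : exists N : nat, forall d, INR N <= d ->
  exists K, 0 <= K /\ forall y, 0 <= y -> Rabs (J d y) <= K * barrier a y.
Proof.
  destruct (INR_unbounded a) as [N hN].
  exists (1 + 2 * N)%nat; intros d hd.
  rewrite plus_INR, mult_INR in hd; simpl in hd.
  destruct (J_decay N d ltac:(lra)) as [K [hK h]].
  exists K; split; [exact hK|]; intros y hy.
  eapply Rle_trans; [apply h, hy|].
  apply Rmult_le_compat_l; [exact hK|].
  unfold barrier; rewrite <- Rpower_pow by lra; rewrite <- Rpower_Ropp.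
  apply Rle_Rpower; lra.
Qed.

(* The energy [G^2 + G'^2] stays away from zero, while [G (x + PI) = - G x + O (x^-2)]
   turns a vanishing lower bound on [G] into a vanishing two-sided one, and then a
   mean value argument makes the energy small. *)
Lemma sturm_not_eventually_nonneg (G G1 : R -> R) mu x0 :
  (forall x, 0 < x -> is_derive G x (G1 x)) ->
  (forall x, 0 < x -> is_derive G1 x (- G x + mu / x ^ 2 * G x)) ->
  0 < x0 -> G x0 <> 0 ->
  (forall eps, 0 < eps -> exists X, forall x, X <= x -> - eps <= G x) ->
  False.
Proof.
  intros hG hG1 hx0 hGx0 hlow.
  set (m := Rabs mu).
  assert (hm : 0 <= m) by apply Rabs_pos.
  set (E := fun x => G x * G x + G1 x * G1 x).
  (* The equation gives [E' = 2 mu G G' / x^2], hence [|E'| <= m E / x^2]. The weighted energy is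
     therefore nonincreasing for [s = 1] and nondecreasing for [s = -1], which bounds [E] above and
     away from 0. *)
  assert (hE : forall s x, 0 < x -> is_derive (fun t => E t * exp (s * (m / t))) x
     (exp (s * (m / x)) * ((2 * mu * (G x * G1 x) - s * m * E x) / x ^ 2))).
  { intros s x hx; unfold E.
    pose proof (hG x hx) as h0; pose proof (hG1 x hx) as h1.
    auto_derive.
    - repeat split; try (eexists; eassumption); lra.
    - rewrite (is_derive_unique (fun x : R => G x) _ _ h0).
      rewrite (is_derive_unique (fun x : R => G1 x) _ _ h1).
      unfold Rdiv; field; lra. }
  assert (hab : forall x, - (m * E x) <= 2 * mu * (G x * G1 x) <= m * E x).
  { intros x; apply Rabs_le_between.
    rewrite (Rmult_comm 2 mu), Rmult_assoc, Rabs_mult; fold m.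
    apply Rmult_le_compat_l; [exact hm|].
    pose proof (Rle_0_sqr (G x - G1 x)) as h1; pose proof (Rle_0_sqr (G x + G1 x)) as h2.
    unfold Rsqr, E in *; apply Rabs_le_between; lra. }
  assert (hE0 : 0 < E x0).
  { unfold E; pose proof (Rle_0_sqr (G1 x0)); pose proof (Rlt_0_sqr _ hGx0).
    unfold Rsqr in *; lra. }
  assert (hMVT : forall s x, x0 <= x -> exists c, x0 <= c <= x /\
     E x * exp (s * (m / x)) - E x0 * exp (s * (m / x0))
     = exp (s * (m / c)) * ((2 * mu * (G c * G1 c) - s * m * E c) / c ^ 2) * (x - x0)).
  { intros s x hx.
    destruct (MVT_gen (fun t => E t * exp (s * (m / t))) x0 x (fun x =>
      exp (s * (m / x)) * ((2 * mu * (G x * G1 x) - s * m * E x) / x ^ 2))) as [c [hc e]].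
    - intros t; rewrite Rmin_left, Rmax_right by lra; intros ht; apply hE; lra.
    - intros t; rewrite Rmin_left, Rmax_right by lra; intros ht.
      apply derivable_continuous_pt, ex_derive_Reals_0; eexists; apply hE; lra.
    - rewrite Rmin_left, Rmax_right in hc by lra; exists c; split; assumption. }
  set (E1 := E x0 * exp (m / x0)); set (E2 := E x0 * exp (- (m / x0))).
  assert (hE2 : 0 < E2) by (apply Rmult_lt_0_compat; [exact hE0|apply exp_pos]).
  assert (hup : forall x, x0 <= x -> E x <= E1).
  { intros x hx; destruct (hMVT 1 x hx) as [c [hc e]].
    assert (0 < c ^ 2) by (apply pow_lt; lra).
    assert (hneg : (2 * mu * (G c * G1 c) - 1 * m * E c) / c ^ 2 <= 0).
    { apply Rle_div_l; [assumption|]; specialize (hab c); lra. }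
    pose proof (exp_pos (1 * (m / c))).
    assert (hexp : 1 <= exp (1 * (m / x))).
    { rewrite <- exp_0 at 1; assert (0 <= m / x) by (apply Rle_div_r; lra).
      destruct (Req_dec (1 * (m / x)) 0) as [->|]; [lra|].
      left; apply exp_increasing; lra. }
    assert (E x * exp (1 * (m / x)) <= E1).
    { unfold E1; rewrite <- (Rmult_1_l (m / x0)).
      assert (exp (1 * (m / c)) * ((2 * mu * (G c * G1 c) - 1 * m * E c) / c ^ 2)
              * (x - x0) <= 0).
      { assert (exp (1 * (m / c)) * ((2 * mu * (G c * G1 c) - 1 * m * E c) / c ^ 2)
                <= 0) by nra.
        nra. }
      lra. }
    assert (0 <= E x).
    { unfold E; pose proof (Rle_0_sqr (G x)); pose proof (Rle_0_sqr (G1 x)).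
      unfold Rsqr in *; lra. }
    nra. }
  assert (hlo : forall x, x0 <= x -> E2 <= E x).
  { intros x hx; destruct (hMVT (-1) x hx) as [c [hc e]].
    assert (0 < c ^ 2) by (apply pow_lt; lra).
    assert (hpos : 0 <= (2 * mu * (G c * G1 c) - -1 * m * E c) / c ^ 2).
    { apply Rle_div_r; [assumption|]; specialize (hab c); lra. }
    pose proof (exp_pos (-1 * (m / c))).
    assert (hexp : exp (-1 * (m / x)) <= 1).
    { rewrite <- exp_0; assert (0 <= m / x) by (apply Rle_div_r; lra).
      destruct (Req_dec (-1 * (m / x)) 0) as [->|]; [lra|].
      left; apply exp_increasing; lra. }
    assert (E2 <= E x * exp (-1 * (m / x))).
    { unfold E2; replace (- (m / x0)) with (-1 * (m / x0)) by ring.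
      assert (0 <= exp (-1 * (m / c)) * ((2 * mu * (G c * G1 c) - -1 * m * E c) / c ^ 2)
              * (x - x0)).
      { apply Rmult_le_pos; [apply Rmult_le_pos|]; lra. }
      lra. }
    assert (0 <= E x).
    { unfold E; pose proof (Rle_0_sqr (G x)); pose proof (Rle_0_sqr (G1 x)).
      unfold Rsqr in *; lra. }
    nra. }
  assert (hGb : forall x, x0 <= x -> Rabs (G x) <= 1 + E1).
  { intros x hx; specialize (hup x hx); unfold E in hup.
    apply Rabs_le_between; nra. }
  assert (hE1 : 0 < E1) by (apply Rmult_lt_0_compat; [exact hE0|apply exp_pos]).
  pose proof PI_RGT_0 as hPI.
  assert (hshift : forall x, x0 <= x ->
            Rabs (G (x + PI) + G x) <= m * (1 + E1) * PI / x ^ 2).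
  { intros x hx.
    (* The Wronskian of [G] with [sin (t - x)], a solution of the unperturbed equation: only the
       term in [mu] survives in [W'], and the increment of [W] over a half period is
       [G (x + PI) + G x]. *)
    set (W := fun t => G1 t * sin (t - x) - G t * cos (t - x)).
    assert (hW : forall t, 0 < t -> is_derive W t (mu / t ^ 2 * G t * sin (t - x))).
    { intros t ht; unfold W.
      pose proof (hG t ht) as h0; pose proof (hG1 t ht) as h1.
      auto_derive.
      - repeat split; try (eexists; eassumption).
      - rewrite (is_derive_unique (fun x : R => G x) _ _ h0).
        rewrite (is_derive_unique (fun x : R => G1 x) _ _ h1).
        unfold Rminus; ring. }
    destruct (MVT_gen W x (x + PI) (fun t => mu / t ^ 2 * G t * sin (t - x)))
      as [c [hc e]].
    - intros t; rewrite Rmin_left, Rmax_right by lra; intros ht; apply hW; lra.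
    - intros t; rewrite Rmin_left, Rmax_right by lra; intros ht.
      apply derivable_continuous_pt, ex_derive_Reals_0; eexists; apply hW; lra.
    - rewrite Rmin_left, Rmax_right in hc by lra.
      assert (e' : G (x + PI) + G x = mu / c ^ 2 * G c * sin (c - x) * PI).
      { unfold W in e.
        replace (x + PI - x) with PI in e by ring; rewrite Rminus_diag in e.
        rewrite sin_PI, cos_PI, sin_0, cos_0 in e; lra. }
      rewrite e', !Rabs_mult, Rabs_div, (Rabs_pos_eq PI) by
        (try apply pow_nonzero; lra); fold m.
      rewrite (Rabs_pos_eq (c ^ 2)) by apply pow2_ge_0.
      assert (hx2 : 0 < x ^ 2) by (apply pow_lt; lra).
      assert (hcx : x ^ 2 <= c ^ 2) by (apply pow_incr; lra).
      assert (hmc : m / c ^ 2 <= m / x ^ 2).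
      { apply Rmult_le_compat_l; [exact hm|apply Rinv_le_contravar; assumption]. }
      assert (hmc0 : 0 <= m / c ^ 2) by (apply Rle_div_r; lra).
      assert (hs : Rabs (sin (c - x)) <= 1).
      { pose proof (SIN_bound (c - x)); apply Rabs_le_between; lra. }
      specialize (hGb c ltac:(lra)).
      pose proof (Rabs_pos (G c)); pose proof (Rabs_pos (sin (c - x))).
      replace (m * (1 + E1) * PI / x ^ 2) with (m / x ^ 2 * (1 + E1) * 1 * PI)
        by (field; lra).
      apply Rmult_le_compat_r; [lra|].
      apply Rmult_le_compat; [nra|lra| |exact hs].
      apply Rmult_le_compat; assumption. }
  (* If [|G| <= eps] on an interval of length 1, the mean value theorem gives a point there with
     [|G'| <= 2 eps], so [E <= 5 eps^2 <= 5 eps < E2]. *)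
  set (eps := Rmin 1 (E2 / 8)).
  assert (heps : 0 < eps) by (apply Rmin_glb_lt; lra).
  assert (he1 : eps <= 1) by apply Rmin_l.
  assert (he2 : eps <= E2 / 8) by apply Rmin_r.
  destruct (hlow (eps / 2) ltac:(lra)) as [X hX].
  set (B := m * (1 + E1) * PI).
  assert (hB : 0 <= B) by (unfold B; apply Rmult_le_pos; [nra|lra]).
  set (X1 := Rmax (Rmax X x0) (Rmax 1 (2 * B / eps))).
  assert (hX1 : X <= X1 /\ x0 <= X1 /\ 1 <= X1 /\ 2 * B / eps <= X1).
  { unfold X1; repeat split; eauto using Rle_trans, Rmax_l, Rmax_r. }
  assert (hsmall : forall x, X1 <= x -> Rabs (G x) <= eps).
  { intros x hx.
    pose proof (hX x ltac:(lra)) as h1; pose proof (hX (x + PI) ltac:(lra)) as h2.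
    pose proof (hshift x ltac:(lra)) as h3; fold B in h3.
    assert (h4 : B / x ^ 2 <= eps / 2).
    { apply Rle_div_l; [apply pow_lt; lra|].
      assert (2 * B <= X1 * eps) by (apply Rle_div_l; [exact heps|lra]).
      assert (X1 <= x ^ 2) by nra.
      assert (X1 * eps <= x ^ 2 * eps) by (apply Rmult_le_compat_r; lra).
      lra. }
    apply Rabs_le_between in h3; apply Rabs_le_between; lra. }
  destruct (MVT_gen G X1 (X1 + 1) G1) as [c [hc e]].
  - intros t; rewrite Rmin_left, Rmax_right by lra; intros ht; apply hG; lra.
  - intros t; rewrite Rmin_left, Rmax_right by lra; intros ht.
    apply derivable_continuous_pt, ex_derive_Reals_0; eexists; apply hG; lra.
  - rewrite Rmin_left, Rmax_right in hc by lra.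
    pose proof (hsmall X1 ltac:(lra)) as h1; pose proof (hsmall (X1 + 1) ltac:(lra)) as h2.
    pose proof (hsmall c ltac:(lra)) as h3; pose proof (hlo c ltac:(lra)) as h4.
    apply Rabs_le_between in h1, h2, h3; unfold E in h4.
    assert (hg1 : - (2 * eps) <= G1 c <= 2 * eps) by (split; nra).
    assert (G c * G c <= eps * eps) by nra.
    assert (G1 c * G1 c <= 4 * (eps * eps)) by nra.
    nra.
Qed.

Lemma Rpower_small s eps : s < 0 -> 0 < eps ->
  exists X, 0 < X /\ forall x, X <= x -> Rpower x s <= eps.
Proof.
  intros hs he; exists (Rpower eps (/ s)); split; [apply exp_pos|]; intros x hx.
  assert (h0 : 0 < Rpower eps (/ s)) by apply exp_pos.
  apply Rle_trans with (Rpower (Rpower eps (/ s)) s).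
  - replace s with (- - s) at 1 3 by ring; rewrite !(Rpower_Ropp _ (- s)).
    apply Rinv_le_contravar; [apply exp_pos|apply Rle_Rpower_l; lra].
  - rewrite Rpower_mult, Rinv_l, Rpower_1 by lra; lra.
Qed.

(** Up to a constant, [G] is [sqrt x] times the Bessel function of order [d - 1]; this removes the
    first-order term and leaves [G'' = (-1 + ga (ga - 1) / x^2) G]. A lower bound of order [y^(-p)]
    on [J d] becomes one of order [x^(ga - 2 p)] on [G], and this exponent is negative exactly when
    [d / 2 - 1/4 < p]. *)
Lemma J_not_above_barrier d p C : 0 < d -> 0 <= p -> d / 2 - / 4 < p -> 0 <= C ->
  ~ (forall y, 0 <= y -> - (C * barrier p y) <= J d y).
Proof.
  intros hd hp hdp hC h.
  set (ga := d - / 2).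
  set (G := fun x => Rpower x ga * J d (x ^ 2 / 4)).
  set (G1 := fun x => Rpower x ga * (ga / x * J d (x ^ 2 / 4)
                       - x / 2 * / d * J (d + 1) (x ^ 2 / 4))).
  destruct (continuity_J d hd 0 (/ 2) ltac:(lra)) as [al [hal hc]].
  set (x0 := Rmin 1 al).
  assert (hx0 : 0 < x0) by (apply Rmin_glb_lt; lra).
  assert (hx01 : x0 <= 1) by apply Rmin_l.
  assert (hx0a : x0 <= al) by apply Rmin_r.
  apply (sturm_not_eventually_nonneg G G1 (ga * (ga - 1)) x0); [| |exact hx0| |].
  - intros x hx; unfold G, G1.
    pose proof (is_derive_J d (x ^ 2 / 4) hd) as h0.
    unfold Rpower; auto_derive.
    + repeat split; try (eexists; eassumption); lra.
    + replace (x * (x * 1) * / 4) with (x ^ 2 / 4) by field.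
      rewrite (is_derive_unique (fun x : R => J d x) _ _ h0).
      field; lra.
  - intros x hx; unfold G, G1.
    pose proof (is_derive_J d (x ^ 2 / 4) hd) as h0.
    pose proof (is_derive_J (d + 1) (x ^ 2 / 4) ltac:(lra)) as h1.
    pose proof (J_rec d (x ^ 2 / 4) hd) as hr.
    unfold Rpower; auto_derive.
    + repeat split; try (eexists; eassumption); lra.
    + replace (x * (x * 1) * / 4) with (x ^ 2 / 4) by field.
      rewrite (is_derive_unique (fun x : R => J d x) _ _ h0).
      rewrite (is_derive_unique (fun x : R => J (d + 1) x) _ _ h1).
      replace (d + 1 + 1) with (d + 2) by ring.
      replace (J (d + 2) (x ^ 2 / 4))
        with (4 * (d * (d + 1) * (J (d + 1) (x ^ 2 / 4) - J d (x ^ 2 / 4))) / x ^ 2)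
        by (rewrite <- hr; field; lra).
      unfold ga; field; lra.
  - assert (hJ : 0 < J d (x0 ^ 2 / 4)).
    { assert (hx2 : 0 < x0 ^ 2 / 4 < al) by nra.
      assert (hcl : R_dist (J d (x0 ^ 2 / 4)) (J d 0) < / 2).
      { apply hc; split; [split; [exact I|lra]|].
        simpl; unfold R_dist; rewrite Rminus_0_r, Rabs_pos_eq; simpl in *; lra. }
      unfold R_dist in hcl; rewrite J_0 in hcl; apply Rabs_def2 in hcl; lra. }
    unfold G; apply Rgt_not_eq, Rmult_lt_0_compat; [apply exp_pos|exact hJ].
  - intros eps heps.
    assert (hs : ga - 2 * p < 0) by (unfold ga; lra).
    (* The power of [1/4] comes from [y = x^2 / 4]; the added 1 keeps [K] positive when [C = 0]. *)
    set (K := C * Rpower (/ 4) (- p) + 1).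
    assert (hK : 0 < K) by (unfold K; pose proof (exp_pos (- p * ln (/ 4))) as hh;
                            change (0 < Rpower (/ 4) (- p)) in hh; nra).
    destruct (Rpower_small _ (eps / K) hs ltac:(apply Rdiv_lt_0_compat; lra)) as [X [hX0 hX]].
    exists X; intros x hx; specialize (hX x hx).
    assert (hx2 : 0 < x ^ 2) by (apply pow_lt; lra).
    specialize (h (x ^ 2 / 4) ltac:(lra)).
    assert (hb : barrier p (x ^ 2 / 4) <= Rpower (/ 4) (- p) * Rpower x (- (2 * p))).
    { unfold barrier; replace (- (2 * p)) with (INR 2 * - p) by (simpl; ring).
      rewrite <- Rpower_mult, Rpower_pow by lra.
      rewrite Rpower_mult_distr by lra.
      rewrite !Rpower_Ropp; apply Rinv_le_contravar; [apply exp_pos|].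
      apply Rle_Rpower_l; lra. }
    assert (hg : 0 < Rpower x ga) by apply exp_pos.
    assert (e : Rpower x (ga - 2 * p) = Rpower x ga * Rpower x (- (2 * p)))
      by (unfold Rminus; apply Rpower_plus).
    assert (hKe : K * Rpower x (ga - 2 * p) <= eps).
    { apply Rle_trans with (K * (eps / K)); [apply Rmult_le_compat_l; lra|].
      right; field; lra. }
    assert (0 < Rpower x (ga - 2 * p)) by apply exp_pos.
    assert (hh : Rpower x ga * (C * barrier p (x ^ 2 / 4))
                 <= C * Rpower (/ 4) (- p) * Rpower x (ga - 2 * p)).
    { rewrite e.
      replace (C * Rpower (/ 4) (- p) * (Rpower x ga * Rpower x (- (2 * p))))
        with (Rpower x ga * (C * (Rpower (/ 4) (- p) * Rpower x (- (2 * p))))) by ring.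
      apply Rmult_le_compat_l; [lra|apply Rmult_le_compat_l; lra]. }
    unfold G; unfold K in hKe; nra.
Qed.

Lemma J_takes_negative d : 0 < d -> exists y, 0 < y /\ J d y < 0.
Proof.
  intros hd; destruct (Classical_Prop.classic (exists y, 0 < y /\ J d y < 0)) as [h|h];
    [exact h|exfalso].
  (* With [C = 0] the lower bound is plain nonnegativity, and [d] serves as an exponent above
     [d / 2 - 1/4]. *)
  apply (J_not_above_barrier d d 0 hd); try lra.
  intros y hy; rewrite Rmult_0_l, Ropp_0.
  destruct (Req_dec y 0) as [->|hy0]; [rewrite J_0; lra|].
  apply Rnot_lt_le; intros hlt; apply h; exists y; split; lra.
Qed.

(** * The necessary condition on b + c *)

Lemma PSeries_scale s p y : PSeries (fun k => s * p k) y = s * PSeries p y.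
Proof. exact (PSeries_scal s p y). Qed.

Lemma res_comm be ga p k : 0 < be -> 0 < ga -> res be (res ga p) k = res ga (res be p) k.
Proof.
  intros hb hg; pose proof (pos_INR k); unfold res; field; lra.
Qed.

Lemma PSeries_res_scal be s p y :
  PSeries (res be (fun k => s * p k)) y = s * PSeries (res be p) y.
Proof.
  rewrite <- PSeries_scal; apply PSeries_ext; intros k.
  change (s * p k / (be + INR k) = s * (p k / (be + INR k))); unfold Rdiv; ring.
Qed.

(* [y^be h] is nondecreasing for [h = res be F], so the average [res ga h] at [2 y]
   sees at least a fixed fraction of [h y]. *)
Lemma res_doubling be ga F : 0 < be -> 0 < ga -> entire F ->
  (forall y, 0 <= y -> 0 <= PSeries F y) ->
  exists K, 0 <= K /\ forall y, 0 <= y ->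
    PSeries (res be F) y <= K * PSeries (res be (res ga F)) (2 * y).
Proof.
  intros hbe hga hF h.
  set (K := Rpower 2 be * Rpower 2 ga * 2).
  assert (h2b : 0 < Rpower 2 be) by apply exp_pos.
  assert (h2g : 0 < Rpower 2 ga) by apply exp_pos.
  assert (hK : 0 < K) by (unfold K; nra).
  pose proof (res_entire be F hbe hF) as hq.
  pose proof (res_entire ga _ hga hq) as hr.
  assert (hq0 : forall y, 0 <= y -> 0 <= PSeries (res be F) y).
  { intros y hy; apply (res_nonneg be F y); auto; try lra; intros; apply h; lra. }
  assert (hr0 : forall y, 0 <= y -> 0 <= PSeries (res ga (res be F)) y).
  { intros y hy; apply (res_nonneg ga _ y); auto; try lra; intros; apply hq0; lra. }
  (* The summand [ga] settles [y = 0], where the two sides differ exactly by that factor; [K]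
     settles [y > 0]. *)
  exists (ga + K); split; [lra|]; intros y hy.
  rewrite (PSeries_ext (res be (res ga F)) (res ga (res be F)))
    by (intros; apply res_comm; assumption).
  destruct (Req_dec y 0) as [->|hy0].
  - rewrite Rmult_0_r; specialize (hr0 0 (Rle_refl 0)); rewrite !PSeries_0 in *.
    unfold res in *; simpl INR in *; rewrite !Rplus_0_r in *.
    replace ((ga + K) * (F O / be / ga)) with (F O / be + K * (F O / be / ga))
      by (field; lra); nra.
  - assert (hyp : 0 < y) by lra.
    (* The derivative of [t^ga * res ga h] is [t^(ga - 1) * h], so its increment over [[y, 2 y]] is
       [y] times this value at some [c], and there [h c >= 2^(-be) * h y]. *)
    destruct (MVT_gen (fun t => Rpower t ga * PSeries (res ga (res be F)) t) y (2 * y)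
      (fun t => Rpower t ga / t * PSeries (res be F) t)) as [c [hc e]].
    + intros t; rewrite Rmin_left, Rmax_right by lra; intros ht.
      rewrite <- (res_ode ga (res be F) t hga hq).
      apply is_derive_Rpower_mult; [lra|apply entire_is_derive, hr].
    + intros t; rewrite Rmin_left, Rmax_right by lra; intros ht.
      apply derivable_continuous_pt, ex_derive_Reals_0; eexists.
      apply is_derive_Rpower_mult; [lra|apply entire_is_derive, hr].
    + rewrite Rmin_left, Rmax_right in hc by lra.
      assert (hm : Rpower y be * PSeries (res be F) y
                   <= Rpower c be * PSeries (res be F) c).
      { apply res_mono; auto; try lra; intros; apply h; lra. }
      assert (hcb : Rpower c be <= Rpower 2 be * Rpower y be).
      { rewrite Rpower_mult_distr by lra; apply Rle_Rpower_l; lra. }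
      assert (hcg : Rpower y ga <= Rpower c ga) by (apply Rle_Rpower_l; lra).
      assert (e2 : Rpower (2 * y) ga = Rpower 2 ga * Rpower y ga)
        by (symmetry; apply Rpower_mult_distr; lra).
      assert (hyb : 0 < Rpower y be) by apply exp_pos.
      assert (hyg : 0 < Rpower y ga) by apply exp_pos.
      pose proof (hq0 c ltac:(lra)) as hqc.
      pose proof (hr0 y ltac:(lra)) as hry; pose proof (hr0 (2 * y) ltac:(lra)) as hr2.
      assert (h1 : PSeries (res be F) y <= Rpower 2 be * PSeries (res be F) c).
      { apply (Rmult_le_reg_l (Rpower y be)); [exact hyb|].
        eapply Rle_trans; [exact hm|].
        rewrite <- Rmult_assoc, (Rmult_comm (Rpower y be)).
        apply Rmult_le_compat_r; assumption. }
      assert (hinv : / (2 * y) <= / c) by (apply Rinv_le_contravar; lra).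
      assert (h3 : Rpower y ga * / 2 <= Rpower c ga / c * y).
      { replace (Rpower y ga * / 2) with (Rpower y ga * / (2 * y) * y) by (field; lra).
        apply Rmult_le_compat_r; [lra|].
        apply Rmult_le_compat; try lra; left; apply Rinv_0_lt_compat; lra. }
      assert (h4 : Rpower y ga * / 2 * PSeries (res be F) c
                   <= Rpower 2 ga * Rpower y ga * PSeries (res ga (res be F)) (2 * y)).
      { rewrite e2 in e.
        assert (0 <= Rpower y ga * PSeries (res ga (res be F)) y)
          by (apply Rmult_le_pos; lra).
        assert (Rpower y ga * / 2 * PSeries (res be F) c
                <= Rpower c ga / c * y * PSeries (res be F) c)
          by (apply Rmult_le_compat_r; assumption).
        replace (2 * y - y) with y in e by ring; nra. }
      assert (h5 : PSeries (res be F) c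
                   <= 2 * Rpower 2 ga * PSeries (res ga (res be F)) (2 * y)).
      { apply (Rmult_le_reg_l (Rpower y ga * / 2)); [lra|].
        eapply Rle_trans; [exact h4|right; field]. }
      eapply Rle_trans; [exact h1|].
      apply Rle_trans with (K * PSeries (res ga (res be F)) (2 * y)).
      * unfold K; replace (Rpower 2 be * Rpower 2 ga * 2
                           * PSeries (res ga (res be F)) (2 * y))
          with (Rpower 2 be * (2 * Rpower 2 ga * PSeries (res ga (res be F)) (2 * y)))
          by ring.
        apply Rmult_le_compat_l; lra.
      * apply Rmult_le_compat_r; lra.
Qed.

(** Averaging with [res (ga + n)] raises the denominator parameter from [ga + n] to [ga + n + 1], up
    to a constant. The parameter can thus be made as large as desired at the price of dilating the
    argument. *)
Lemma res_doubling_iter be ga F n : 0 < be -> 0 < ga -> entire F ->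
  (forall y, 0 <= y -> 0 <= PSeries F y) ->
  exists K, 0 <= K /\ forall y, 0 <= y ->
    PSeries (res be F) y <= K * PSeries (res be (beta ga (ga + INR n) F)) (2 ^ n * y).
Proof.
  intros hbe hga hF h; induction n as [|n [K [hK IH]]].
  - exists 1; split; [lra|]; intros y hy; rewrite !Rmult_1_l.
    right; apply PSeries_ext; intros k; apply res_ext; intros j.
    unfold beta; simpl; rewrite Rplus_0_r; pose proof (poch_pos ga j hga); field; lra.
  - pose proof (pos_INR n) as hn.
    assert (hF' : entire (beta ga (ga + INR n) F)) by (apply beta_entire; auto; lra).
    destruct (res_doubling be (ga + INR n) _ hbe ltac:(lra) hF') as [K1 [hK1 h1]].
    { intros y hy; apply (beta_nonneg _ _ _ y); auto; try lra; intros; apply h; lra. }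
    exists (K * (K1 * / (ga + INR n))); split.
    { apply Rmult_le_pos; [exact hK|apply Rmult_le_pos; [exact hK1|]].
      left; apply Rinv_0_lt_compat; lra. }
    intros y hy.
    assert (hp2 : 0 < 2 ^ n) by (apply pow_lt; lra).
    eapply Rle_trans; [apply IH, hy|].
    rewrite !Rmult_assoc; apply Rmult_le_compat_l; [exact hK|].
    eapply Rle_trans; [apply h1; nra|right].
    simpl pow; rewrite <- Rmult_assoc; f_equal.
    rewrite <- PSeries_res_scal; apply PSeries_ext; intros k; apply res_ext; intros j.
    rewrite S_INR, <- Rplus_assoc; unfold beta, res; rewrite poch_shift by lra.
    pose proof (pos_INR j); pose proof (poch_pos (ga + INR n) j ltac:(lra)).
    field; repeat split; lra.
Qed.

Lemma barrier_antitone a s t : 0 <= a -> 0 <= s <= t -> barrier a t <= barrier a s.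
Proof.
  intros ha hst; unfold barrier; rewrite !Rpower_Ropp.
  apply Rinv_le_contravar; [apply exp_pos|apply Rle_Rpower_l; lra].
Qed.

Lemma beta_succ a p k : 0 < a -> beta a (a + 1) p k = a * res a p k.
Proof.
  intros ha; unfold beta, res; rewrite poch_shift by exact ha.
  pose proof (poch_pos a k ha); pose proof (pos_INR k); field; repeat split; lra.
Qed.

(** For large [c], [bes c] decays to order [a + 1]. The passage from [(a)_k] to [(a + 1)_k] is the
    critical resolvent, which costs one order; the remaining passage from [a + 1] to [b + 1] lies
    strictly above the rate [a] and preserves it. *)
Lemma hyp_decay a b : 0 < a < b -> exists N : nat, forall c, INR N <= c -> 0 < c ->
  exists K, 0 <= K /\ forall y, 0 <= y ->
    Rabs (PSeries (hyp a (b + 1) c) y) <= K * barrier a y.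
Proof.
  intros hab; destruct (J_barrier (a + 1)) as [N hN]; exists N; intros c hc hc0.
  destruct (hN c hc) as [K [hK h]].
  destruct (beta_barrier a (a + 1) (b + 1) ltac:(lra) ltac:(lra)) as [K1 [hK1 h1]].
  pose proof (bes_entire c hc0) as hbes.
  assert (hr : entire (beta a (a + 1) (bes c))) by (apply beta_entire; auto; lra).
  exists (K * K1); split; [apply Rmult_le_pos; assumption|]; intros y hy.
  rewrite (PSeries_ext _ (beta (a + 1) (b + 1) (beta a (a + 1) (bes c)))).
  - apply h1; auto; intros z hz.
    rewrite (PSeries_ext _ _ z (fun k => beta_succ a (bes c) k ltac:(lra))).
    rewrite PSeries_scale, Rabs_mult, Rabs_pos_eq by lra.
    replace (K * barrier a z) with (a * (K / a * barrier a z)) by (field; lra).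
    apply Rmult_le_compat_l; [lra|].
    apply res_barrier_critical; auto; lra.
  - intros k; unfold hyp, beta, bes.
    pose proof (poch_pos (a + 1) k ltac:(lra)); pose proof (poch_pos (b + 1) k ltac:(lra)).
    pose proof (poch_pos c k hc0); pose proof (INR_fact_lt_0 k); field; lra.
Qed.

(** Since [res b] turns [hyp a b c] into [hyp a (b + 1) c / b], doubling [N] times reaches the case
    of [hyp_decay]. The dilation by [2^N] is harmless because the barrier decreases. *)
Lemma res_hyp_decay a b c : 0 < a < b -> 0 < c ->
  (forall y, 0 <= y -> 0 <= PSeries (hyp a b c) y) ->
  exists K, 0 <= K /\ forall y, 0 <= y ->
    PSeries (res b (hyp a b c)) y <= K * barrier a y.
Proof.
  intros hab hc h.
  destruct (hyp_decay a b hab) as [N hN].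
  destruct (hN (c + INR N) ltac:(lra) ltac:(pose proof (pos_INR N); lra)) as [K [hK hd]].
  destruct (res_doubling_iter b c (hyp a b c) N ltac:(lra) hc
    ltac:(apply hyp_entire; lra) h) as [K1 [hK1 h1]].
  exists (K1 * (/ b * K)); split.
  { apply Rmult_le_pos; [exact hK1|apply Rmult_le_pos; [|exact hK]].
    left; apply Rinv_0_lt_compat; lra. }
  intros y hy; pose proof (pos_INR N) as hn.
  assert (hp2 : 1 <= 2 ^ N) by (apply pow_R1_Rle; lra).
  eapply Rle_trans; [apply h1, hy|].
  rewrite !Rmult_assoc; apply Rmult_le_compat_l; [exact hK1|].
  rewrite (PSeries_ext _ (fun k => / b * hyp a (b + 1) (c + INR N) k)).
  - rewrite PSeries_scale.
    apply Rmult_le_compat_l; [left; apply Rinv_0_lt_compat; lra|].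
    eapply Rle_trans; [apply Rle_abs|].
    eapply Rle_trans; [apply hd; nra|].
    apply Rmult_le_compat_l; [exact hK|apply barrier_antitone; nra].
  - intros k; unfold hyp, beta, res; rewrite poch_shift by lra.
    pose proof (poch_pos b k ltac:(lra)); pose proof (poch_pos c k hc).
    pose proof (poch_pos (c + INR N) k ltac:(lra)).
    pose proof (pos_INR k); pose proof (INR_fact_lt_0 k); field; repeat split; lra.
Qed.

(** The resolvent identity [res ga = res be - (ga - be) res ga res be], whose last term is
    nonnegative on nonnegative functions. *)
Lemma res_le_res be ga F : 0 < be <= ga -> entire F ->
  (forall y, 0 <= y -> 0 <= PSeries F y) ->
  forall y, 0 <= y -> PSeries (res ga F) y <= PSeries (res be F) y.
Proof.
  intros hbg hF h y hy.
  assert (hb : entire (res be F)) by (apply res_entire; auto; lra).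
  assert (hg : 0 <= PSeries (res ga (res be F)) y).
  { apply (res_nonneg ga _ y); auto; try lra; intros z hz.
    apply (res_nonneg be F z); auto; try lra; intros; apply h; lra. }
  rewrite (PSeries_ext (res ga F)
    (fun k => 1 * res be F k + - (ga - be) * res ga (res be F) k)).
  - rewrite PSeries_lin; auto; [nra|apply res_entire; auto; lra].
  - intros k; unfold res; pose proof (pos_INR k); field; lra.
Qed.

(** The ratio of [hyp a b c n] to [bes d n]. Evaluated at [k + n] and divided by its value at [n],
    it is the part of this ratio left after the first [n] factors of the reverse multiplier. *)
Definition kap (a b c d : R) (n : nat) : R :=
  poch a n * poch d n / (poch b n * poch c n).

Lemma kap_S a b c d n : 0 < b -> 0 < c ->
  kap a b c d (S n)
  = kap a b c d n * ((a + INR n) * (d + INR n) / ((b + INR n) * (c + INR n))).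
Proof.
  intros hb hc; unfold kap; simpl.
  pose proof (poch_pos b n hb); pose proof (poch_pos c n hc); pose proof (pos_INR n).
  field; repeat split; lra.
Qed.

Lemma kap_pos a b c d n : 0 < a -> 0 < b -> 0 < c -> 0 < d -> 0 < kap a b c d n.
Proof.
  intros; unfold kap; apply Rdiv_lt_0_compat; apply Rmult_lt_0_compat; apply poch_pos; lra.
Qed.

Lemma kap_factor_le a b c d n : 0 < a -> a <= b -> a <= c -> d = b + c - a ->
  (a + INR n) * (d + INR n) / ((b + INR n) * (c + INR n)) <= 1.
Proof.
  intros ha hb hc ->; pose proof (pos_INR n).
  apply Rle_div_l; [apply Rmult_lt_0_compat; lra|nra].
Qed.

Lemma kap_ratio_le a b c d n k : 0 < a -> a <= b -> a <= c -> d = b + c - a ->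
  kap a b c d (k + n) <= kap a b c d n.
Proof.
  intros ha hb hc hd; induction k as [|k IH]; [apply Rle_refl|].
  change (S k + n)%nat with (S (k + n)); rewrite kap_S by lra.
  pose proof (kap_pos a b c d (k + n) ltac:(lra) ltac:(lra) ltac:(lra) ltac:(lra)).
  pose proof (kap_factor_le a b c d (k + n) ha hb hc hd).
  nra.
Qed.

Lemma kap_ratio_lim a b c d k : 0 < a -> 0 < b -> 0 < c -> 0 < d ->
  is_lim_seq (fun n => kap a b c d (k + n) / kap a b c d n) 1.
Proof.
  intros ha hb hc hd; induction k as [|k IH].
  - apply is_lim_seq_ext with (fun _ => 1); [|apply is_lim_seq_const].
    intros n; pose proof (kap_pos a b c d n ha hb hc hd); simpl; field; lra.
  - apply is_lim_seq_ext with (fun n => kap a b c d (k + n) / kap a b c d n *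
      ((a + INR k + INR n) / (b + INR k + INR n)
       * ((d + INR k + INR n) / (c + INR k + INR n)))).
    + intros n; change (S k + n)%nat with (S (k + n)); rewrite kap_S by lra.
      rewrite plus_INR; pose proof (kap_pos a b c d n ha hb hc hd).
      pose proof (pos_INR n); pose proof (pos_INR k).
      field; repeat split; lra.
    + replace (Finite 1) with (Finite (1 * (1 * 1))) by (f_equal; ring).
      apply is_lim_seq_mult'; [exact IH|].
      apply is_lim_seq_mult'; apply is_lim_seq_INR_ratio.
Qed.

(** The reciprocal factors are [1 + (b - a) (c - a) / ((a + n) (d + n))], whose product converges;
    normalizing by [kap] therefore costs only a constant. *)
Lemma kap_inv_bounded a b c d : 0 < a -> a < b -> a < c -> d = b + c - a ->
  exists K, 0 <= K /\ forall n, / kap a b c d n <= K.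
Proof.
  intros ha hb hc hd.
  set (K := (b - a) * (c - a) * ((1 + / a) * (1 + 2 / d))).
  assert (hK : 0 <= K)
    by (unfold K; apply Rmult_le_pos; [nra|apply inv_quadratic_const_pos; lra]).
  exists (exp K); split; [left; apply exp_pos|]; intros n.
  assert (h0 : kap a b c d O = 1) by (unfold kap; simpl; field).
  replace (exp K) with (/ kap a b c d O * exp K) by (rewrite h0; field).
  apply (prod_bound (fun n => / kap a b c d n)); [exact hK|rewrite h0; lra|].
  clear n; intros n _.
  pose proof (kap_pos a b c d n ltac:(lra) ltac:(lra) ltac:(lra) ltac:(lra)) as hp.
  pose proof (kap_pos a b c d (S n) ltac:(lra) ltac:(lra) ltac:(lra) ltac:(lra)) as hp1.
  split; [left; apply Rinv_0_lt_compat, hp1|].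
  rewrite kap_S by lra; pose proof (pos_INR n) as hn.
  replace (/ (kap a b c d n * ((a + INR n) * (d + INR n) / ((b + INR n) * (c + INR n)))))
    with (/ kap a b c d n * (1 + (b - a) * (c - a) * / ((a + INR n) * (d + INR n)))).
  - apply Rmult_le_compat_l; [left; apply Rinv_0_lt_compat, hp|].
    apply Rplus_le_compat_l.
    apply Rle_trans with ((b - a) * (c - a) * (((1 + / a) * (1 + 2 / d))
                                          / (INR (S n) * INR (S (S n))))).
    + apply Rmult_le_compat_l; [nra|apply inv_quadratic_le; lra].
    + right; unfold K, Rdiv; ring.
  - rewrite hd; field; rewrite <- hd; repeat split; lra.
Qed.

(* With [d = b + c - a], [(a)_k (d)_k / ((b)_k (c)_k)] tends to a positive limit and
   [(x + a) (x + d) / ((x + b) (x + c)) = 1 - (b - a) (c - a) / ((x + b) (x + c))].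
   Applying [1 - (b - a) (c - a) res (b + i) (res (c + i))] for all [i] thus turns
   [hyp a b c] into a positive multiple of [bes d], and every resolvent of a
   nonnegative function decays like the barrier. *)
Lemma J_lower_barrier a b c : 0 < a -> a < b -> b <= c ->
  (forall y, 0 <= y -> 0 <= PSeries (hyp a b c) y) ->
  exists A, 0 <= A /\ forall y, 0 <= y -> - (A * barrier a y) <= J (b + c - a) y.
Proof.
  intros ha hab hbc h.
  set (d := b + c - a); set (eta := (b - a) * (c - a)); set (p := hyp a b c).
  assert (heta : 0 < eta) by (unfold eta; nra).
  assert (hp : entire p) by (apply hyp_entire; lra).
  destruct (res_hyp_decay a b c ltac:(lra) ltac:(lra) h) as [K [hK hR]]; fold p in hR.
  pose proof (bes_entire d ltac:(unfold d; lra)) as hbes.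
  (* The series after [n] factors: [G 0] has the coefficients [p], and [G n] divided by
     [kap a b c d n] tends to [bes d]. *)
  set (G := fun n k => kap a b c d (k + n) * bes d k).
  assert (hkp : forall n, 0 < kap a b c d n)
    by (intros; apply kap_pos; unfold d; lra).
  assert (hG : forall n, entire (G n)).
  { intros n; apply (entire_dominated (bes d) _ (kap a b c d n) hbes); intros k.
    unfold G; rewrite Rabs_mult, Rabs_pos_eq by (left; apply hkp).
    apply Rmult_le_compat_r; [apply Rabs_pos|apply kap_ratio_le; unfold d; lra]. }
  set (rr := fun n q => res (b + INR n) (res (c + INR n) q)).
  assert (hrr : forall n q, entire q -> entire (rr n q)).
  { intros n q hq; pose proof (pos_INR n); apply res_entire; [lra|].
    apply res_entire; [lra|exact hq]. }
  (* The first-order part of what the factors subtract: the sum over [i < n] of the double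
     resolvents of [p] itself. *)
  set (T := fix T n k := match n with O => 0 | S n => T n k + rr n p k end).
  assert (hT : forall n, entire (T n)).
  { induction n as [|n IH].
    - apply (entire_dominated p _ 0 hp); intros k; simpl; rewrite Rabs_R0; lra.
    - apply (entire_dominated _ _ 1 (entire_lin _ _ 1 1 IH (hrr n p hp))).
      intros k; simpl; rewrite !Rmult_1_l; lra. }
  assert (hTS : forall n y, PSeries (T (S n)) y = PSeries (T n) y + PSeries (rr n p) y).
  { intros n y; rewrite <- (Rmult_1_l (PSeries (T n) y)).
    rewrite <- (Rmult_1_l (PSeries (rr n p) y)), <- PSeries_lin; auto.
    apply PSeries_ext; intros k; simpl; ring. }
  assert (hres0 : forall be q, 0 < be -> entire q ->
            (forall y, 0 <= y -> 0 <= PSeries q y) ->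
            forall y, 0 <= y -> 0 <= PSeries (res be q) y).
  { intros be q hbe hq hq0 y hy; apply (res_nonneg be q y); auto; try lra.
    intros; apply hq0; lra. }
  assert (hT0 : forall n y, 0 <= y -> 0 <= PSeries (T n) y).
  { induction n as [|n IH]; intros y hy.
    - right; symmetry; rewrite (PSeries_ext _ (fun k => 0 * p k))
        by (intros; simpl; ring); rewrite PSeries_scale; ring.
    - rewrite hTS; apply Rplus_le_le_0_compat; [auto|]; pose proof (pos_INR n).
      apply hres0; auto; [lra|apply res_entire; auto; lra|].
      apply hres0; auto; lra. }
  assert (hb0 : entire (res b p)) by (apply res_entire; auto; lra).
  assert (hbb : forall y, 0 <= y -> PSeries (res b (res b p)) y <= K / (b - a) * barrier a y).
  { intros y hy; eapply Rle_trans; [apply Rle_abs|].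
    apply res_barrier; auto; try lra; intros z hz.
    rewrite Rabs_pos_eq; [auto|apply hres0; auto; lra]. }
  (* For [i >= 1], [b <= c] allows [res (c + i)] to be replaced by the larger [res (b + i - 1)], and
     [res (b + i - 1) res (b + i)] is the difference of the two resolvents. The sum telescopes, so
     its bound is uniform in [n]. *)
  assert (hT1 : forall n y, 0 <= y -> PSeries (T (S n)) y
            <= PSeries (res b (res b p)) y + PSeries (res b p) y
               - PSeries (res (b + INR n) p) y).
  { induction n as [|n IH]; intros y hy; rewrite hTS.
    - assert (hle : PSeries (rr O p) y <= PSeries (res b (res b p)) y).
      { unfold rr; simpl; rewrite !Rplus_0_r.
        rewrite (PSeries_ext _ (res c (res b p))) by (intros; apply res_comm; lra).
        apply res_le_res; auto; [lra|]; intros; apply hres0; auto; lra. }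
      assert (e : PSeries (T O) y = 0).
      { rewrite (PSeries_ext _ (fun k => 0 * p k)) by (intros; simpl; ring).
        rewrite PSeries_scale; ring. }
      simpl INR; rewrite Rplus_0_r; lra.
    - specialize (IH y hy); pose proof (pos_INR n) as hn; rewrite S_INR.
      assert (hle : PSeries (rr (S n) p) y
                <= PSeries (res (b + INR n) (res (b + (INR n + 1)) p)) y).
      { unfold rr; rewrite S_INR.
        rewrite (PSeries_ext _ (res (c + (INR n + 1)) (res (b + (INR n + 1)) p)))
          by (intros; apply res_comm; lra).
        apply res_le_res; auto; [lra|apply res_entire; auto; lra|].
        intros; apply hres0; auto; lra. }
      rewrite (PSeries_ext (res (b + INR n) (res (b + (INR n + 1)) p))
        (fun k => 1 * res (b + INR n) p k + - (1) * res (b + (INR n + 1)) p k)) in hle.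
      + rewrite PSeries_lin in hle; [lra| |]; apply res_entire; auto; lra.
      + intros k; pose proof (pos_INR k); unfold res; field; lra. }
  set (A0 := K / (b - a) + K).
  assert (hKb : 0 <= K / (b - a)) by (apply Rle_div_r; lra).
  assert (hA0 : 0 <= A0) by (unfold A0; lra).
  assert (hTb : forall n y, 0 <= y -> PSeries (T n) y <= A0 * barrier a y).
  { intros [|n] y hy.
    - rewrite (PSeries_ext _ (fun k => 0 * p k)) by (intros; simpl; ring).
      rewrite PSeries_scale, Rmult_0_l; pose proof (barrier_pos a y); nra.
    - eapply Rle_trans; [apply hT1, hy|].
      specialize (hbb y hy); specialize (hR y hy); pose proof (pos_INR n).
      assert (0 <= PSeries (res (b + INR n) p) y) by (apply hres0; auto; lra).
      unfold A0; lra. }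
  (* The higher-order remainder [G n - p + eta T n], with [E n = G n - p]. The step from [n] to
     [n + 1] changes [D] by [- eta rr n (E n)]: the term in [p] has been absorbed by [T], so
     two-sided barrier bounds propagate although none is known for [p]. *)
  set (D := fun n k => 1 * (1 * G n k + -1 * p k) + eta * T n k).
  assert (hD : forall n, entire (D n)) by (intros; repeat apply entire_lin; auto).
  set (E := fun n k => 1 * D n k + - eta * T n k).
  assert (hE : forall n, entire (E n)) by (intros; apply entire_lin; auto).
  assert (hDS : forall n k, D (S n) k = 1 * D n k + - eta * rr n (E n) k).
  { intros n k; unfold E, D, G, rr, res; rewrite Nat.add_succ_r, kap_S by lra.
    rewrite plus_INR; simpl T; unfold rr, res.
    pose proof (pos_INR n); pose proof (pos_INR k).
    unfold eta, d; field; lra. }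
  (* [bd n] bounds [E n], and [bd n - eta * A0] bounds [D n]; the increment is what two applications
     of [res_barrier] produce. *)
  set (bd := fix bd n := match n with O => eta * A0
    | S n => bd n * (1 + eta * / ((c - a + INR n) * (b - a + INR n))) end).
  set (KS := eta * ((1 + / (c - a)) * (1 + 2 / (b - a)))).
  assert (hKS : 0 <= KS).
  { unfold KS; apply Rmult_le_pos; [lra|apply inv_quadratic_const_pos; lra]. }
  assert (hS : forall n, 0 <= bd n <= bd O * exp KS).
  { apply prod_bound; [exact hKS|simpl; nra|]; intros n hn.
    pose proof (pos_INR n) as hi.
    pose proof (inv_quadratic_le (c - a) (b - a) n ltac:(lra) ltac:(lra)) as hq.
    assert (0 < / ((c - a + INR n) * (b - a + INR n))) by (apply Rinv_0_lt_compat; nra).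
    simpl bd; split; [apply Rmult_le_pos; [exact hn|nra]|].
    apply Rmult_le_compat_l; [exact hn|apply Rplus_le_compat_l].
    apply Rle_trans with (eta * (((1 + / (c - a)) * (1 + 2 / (b - a)))
                                 / (INR (S n) * INR (S (S n))))).
    - apply Rmult_le_compat_l; lra.
    - right; unfold KS, Rdiv; ring. }
  assert (hDb : forall n y, 0 <= y ->
            Rabs (PSeries (D n) y) <= (bd n - eta * A0) * barrier a y).
  { induction n as [|n IH]; intros y hy.
    - rewrite (PSeries_ext _ (fun k => 0 * p k)).
      + rewrite PSeries_scale, Rmult_0_l, Rabs_R0; simpl; rewrite Rminus_diag; lra.
      + intros k; unfold D, G, kap, p, hyp, bes; rewrite Nat.add_0_r; simpl T.
        pose proof (poch_pos b k ltac:(lra)); pose proof (poch_pos c k ltac:(lra)).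
        pose proof (poch_pos d k ltac:(unfold d; lra)).
        pose proof (INR_fact_lt_0 k); field; repeat split; lra.
    - pose proof (pos_INR n) as hn.
      assert (hEb : forall z, 0 <= z -> Rabs (PSeries (E n) z) <= bd n * barrier a z).
      { intros z hz; unfold E; rewrite PSeries_lin by auto.
        specialize (IH z hz); specialize (hT0 n z hz); specialize (hTb n z hz).
        apply Rabs_le_between in IH; apply Rabs_le_between.
        assert (eta * PSeries (T n) z <= eta * (A0 * barrier a z))
          by (apply Rmult_le_compat_l; lra).
        assert (0 <= eta * PSeries (T n) z) by (apply Rmult_le_pos; lra).
        pose proof (barrier_pos a z); nra. }
      pose proof (res_barrier (bd n) a (c + INR n) (E n) ltac:(lra) (hE n) hEb) as h1.
      pose proof (res_barrier _ a (b + INR n) _ ltac:(lra)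
                    (res_entire (c + INR n) (E n) ltac:(lra) (hE n)) h1 y hy) as h2.
      rewrite (PSeries_ext _ _ y (hDS n)), PSeries_lin by auto.
      specialize (IH y hy); fold (rr n (E n)) in h2.
      eapply Rle_trans; [apply Rabs_triang|].
      rewrite !Rabs_mult, Rabs_Ropp, Rabs_R1, Rmult_1_l, (Rabs_pos_eq eta) by lra.
      apply Rle_trans with ((bd n - eta * A0) * barrier a y
        + eta * (bd n / (c + INR n - a) / (b + INR n - a) * barrier a y)).
      + apply Rplus_le_compat; [exact IH|apply Rmult_le_compat_l; lra].
      + right; simpl bd; field; lra. }
  destruct (kap_inv_bounded a b c d ha hab ltac:(lra) eq_refl) as [Ki [hKi hki]].
  set (A := bd O * exp KS).
  assert (hA : 0 <= A) by (unfold A; specialize (hS O); lra).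
  exists (Ki * A); split; [apply Rmult_le_pos; assumption|]; intros y hy.
  apply (is_lim_seq_le (fun _ => - (Ki * A * barrier a y))
    (fun n => PSeries (fun k => kap a b c d (k + n) / kap a b c d n * bes d k) y)
    (- (Ki * A * barrier a y)) (J d y)).
  - intros n; rewrite (PSeries_ext _ (fun k => / kap a b c d n * G n k))
      by (intros; unfold G, Rdiv; ring).
    rewrite PSeries_scale.
    (* Here [G n = p + D n - eta T n], and [p] is simply dropped because it is nonnegative. *)
    assert (hGl : - (A * barrier a y) <= PSeries (G n) y).
    { rewrite (PSeries_ext _ (fun k => 1 * p k + 1 * E n k))
        by (intros; unfold E, D; ring).
      rewrite PSeries_lin by auto; unfold E; rewrite PSeries_lin by auto.
      specialize (hDb n y hy); apply Rabs_le_between in hDb.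
      specialize (hTb n y hy); specialize (h y hy); fold p in h.
      assert (eta * PSeries (T n) y <= eta * (A0 * barrier a y))
        by (apply Rmult_le_compat_l; lra).
      assert (bd n * barrier a y <= A * barrier a y).
      { apply Rmult_le_compat_r; [left; apply barrier_pos|apply hS]. }
      lra. }
    assert (0 < / kap a b c d n) by (apply Rinv_0_lt_compat, hkp).
    assert (0 <= A * barrier a y)
      by (apply Rmult_le_pos; [exact hA|left; apply barrier_pos]).
    specialize (hki n); nra.
  - apply is_lim_seq_const.
  - unfold J; rewrite (PSeries_ext (bes d) (fun k => 1 * bes d k)) by (intros; ring).
    apply (PSeries_multiplier_lim (bes d) (fun n k => kap a b c d (k + n) / kap a b c d n)
             (fun _ => 1)); [exact hbes| |].
    + intros n k; rewrite Rabs_pos_eq by (left; apply Rdiv_lt_0_compat; apply hkp).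
      apply Rle_div_l; [apply hkp|rewrite Rmult_1_l; apply kap_ratio_le; unfold d; lra].
    + intros k; apply kap_ratio_lim; unfold d; lra.
Qed.

Lemma hyp_nonneg_sum a b c : 0 < a -> a < b -> b <= c ->
  (forall y, 0 <= y -> 0 <= PSeries (hyp a b c) y) -> 3 * a + 1 / 2 <= b + c.
Proof.
  intros ha hab hbc h; apply Rnot_lt_le; intros hlt.
  destruct (J_lower_barrier a b c ha hab hbc h) as [A [hA hJ]].
  apply (J_not_above_barrier (b + c - a) a A); try lra; exact hJ.
Qed.

(** * The square of a Bessel function *)

(** Falling factorials let the quotients [(A)_n / (A)_(n - k)] be written as [falling x k] with
    [x = A + n - 1] independent of [k], as Vandermonde's convolution requires. *)
Fixpoint falling (x : R) (k : nat) : R :=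
  match k with O => 1 | S k => falling x k * (x - INR k) end.

Lemma poch_falling s k : 0 < s -> poch s k = falling (s + INR k - 1) k.
Proof.
  revert s; induction k as [|k IH]; intros s hs; [reflexivity|].
  pose proof (poch_shift s k hs) as h; rewrite IH in h by lra.
  cbn [poch falling]; rewrite !S_INR.
  replace (s + (INR k + 1) - 1) with (s + 1 + INR k - 1) by ring.
  rewrite h; field; lra.
Qed.

Lemma vandermonde x y n :
  sum_f_R0 (fun k => falling x k / INR (Factorial.fact k)
                     * (falling y (n - k) / INR (Factorial.fact (n - k)))) n
  = falling (x + y) n / INR (Factorial.fact n).
Proof.
  set (B := fun x k => falling x k / INR (Factorial.fact k)).
  assert (hB : forall x k, INR (S k) * B x (S k) = (x - INR k) * B x k).
  { intros z k; unfold B; rewrite fact_simpl, mult_INR; simpl falling.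
    pose proof (INR_fact_lt_0 k); pose proof (lt_0_INR (S k) ltac:(lia)).
    field; lra. }
  change (sum_f_R0 (fun k => B x k * B y (n - k)%nat) n = B (x + y) n).
  induction n as [|n IH]; [unfold B; simpl; field|].
  pose proof (lt_0_INR (S n) ltac:(lia)) as hn.
  apply (Rmult_eq_reg_l (INR (S n))); [|lra].
  rewrite hB, <- IH, !scal_sum.
  (* The factor [n + 1] is split as [k + (n + 1 - k)], one part for each binomial. The vanishing end
     terms are removed and the first sum is shifted, after which
     [(x - k) + (y - (n - k)) = x + y - n]. *)
  rewrite (sum_eq _ (fun k => INR k * B x k * B y (S n - k)%nat
                       + B x k * (INR (S n - k) * B y (S n - k)%nat))).
  2: { intros k hk; rewrite minus_INR by lia; ring. }
  rewrite sum_plus.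
  rewrite decomp_sum by lia; simpl pred.
  rewrite (tech5 (fun k => B x k * (INR (S n - k) * B y (S n - k)%nat))).
  rewrite Nat.sub_diag; simpl (INR 0).
  rewrite !Rmult_0_l, Rmult_0_r, Rplus_0_l, Rplus_0_r, <- sum_plus.
  apply sum_eq; intros k hk.
  rewrite (Nat.sub_succ_l k n) by lia; rewrite hB.
  change (S n - S k)%nat with (n - k)%nat.
  rewrite hB, minus_INR by lia; ring.
Qed.

Lemma poch_duplication a n : 0 < a ->
  poch (2 * a) (n + n) = 4 ^ n * poch a n * poch (a + / 2) n.
Proof.
  intros ha; induction n as [|n IH]; [simpl; ring|].
  rewrite Nat.add_succ_r; simpl Nat.add; simpl poch; rewrite IH.
  change (match (n + n)%nat with O => 1 | S _ => INR (n + n) + 1 end) with (INR (S (n + n))).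
  rewrite S_INR, plus_INR; simpl pow; field.
Qed.

(** Multiplied by [(A)_n^2], the Cauchy product is a Vandermonde sum with value
    [falling (2 x) n / n!]. As [2 x = 2 a + 2 n - 1], that falling factorial is
    [(2 a)_(2 n) / (2 a)_n], and the duplication formula finishes. *)
Lemma bes_square_coef a n : 0 < a ->
  sum_f_R0 (fun k => (/ 4) ^ k * bes (a + / 2) k
                     * ((/ 4) ^ (n - k) * bes (a + / 2) (n - k))) n
  = hyp a (a + / 2) (2 * a) n.
Proof.
  intros ha; set (A := a + / 2).
  assert (hA : 0 < A) by (unfold A; lra).
  pose proof (poch_pos A n hA) as hAn; pose proof (poch_pos a n ha) as han.
  pose proof (poch_pos (2 * a) n ltac:(lra)) as h2an; pose proof (INR_fact_lt_0 n) as hf.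
  set (x := A + INR n - 1).
  rewrite (sum_eq _ (fun k => falling x k / INR (Factorial.fact k)
      * (falling x (n - k) / INR (Factorial.fact (n - k)))
      * ((- / 4) ^ n / (poch A n * poch A n)))).
  - rewrite <- scal_sum, vandermonde.
    assert (e : falling (x + x) n * poch (2 * a) n = 4 ^ n * poch a n * poch A n).
    { unfold A; rewrite <- poch_duplication, poch_add, Rmult_comm by exact ha.
      f_equal; rewrite (poch_falling (2 * a + INR n)) by (pose proof (pos_INR n); lra).
      f_equal; unfold x, A; field. }
    assert (e' : falling (x + x) n = 4 ^ n * poch a n * poch A n / poch (2 * a) n)
      by (rewrite <- e; field; lra).
    rewrite e'; unfold hyp; fold A.
    replace ((- / 4) ^ n) with ((-1) ^ n * / 4 ^ n)
      by (rewrite <- pow_inv, <- Rpow_mult_distr; f_equal; field).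
    assert (h4 : 4 ^ n <> 0) by (apply pow_nonzero; lra).
    field; repeat split; lra.
  - intros k hk; unfold bes.
    assert (hf1 : falling x k * poch A (n - k) = poch A n).
    { replace n with ((n - k) + k)%nat at 2 by lia; rewrite poch_add, Rmult_comm.
      f_equal; pose proof (pos_INR (n - k)).
      rewrite poch_falling by lra; f_equal; unfold x; rewrite minus_INR by lia; ring. }
    assert (hf2 : falling x (n - k) * poch A k = poch A n).
    { replace n with (k + (n - k))%nat at 2 by lia; rewrite poch_add, Rmult_comm.
      f_equal; pose proof (pos_INR k).
      rewrite poch_falling by lra; f_equal; unfold x; rewrite minus_INR by lia; ring. }
    pose proof (poch_pos A k hA); pose proof (poch_pos A (n - k) hA).
    pose proof (INR_fact_lt_0 k); pose proof (INR_fact_lt_0 (n - k)).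
    replace ((- / 4) ^ n) with (((/ 4) ^ k * (-1) ^ k) * ((/ 4) ^ (n - k) * (-1) ^ (n - k))).
    2: { rewrite <- !Rpow_mult_distr, <- pow_add; f_equal; [lra|lia]. }
    replace (falling x k) with (poch A n / poch A (n - k)) by (rewrite <- hf1; field; lra).
    replace (falling x (n - k)) with (poch A n / poch A k) by (rewrite <- hf2; field; lra).
    field; repeat split; lra.
Qed.

Lemma J_square a y : 0 < a ->
  PSeries (hyp a (a + / 2) (2 * a)) y = J (a + / 2) (y / 4) * J (a + / 2) (y / 4).
Proof.
  intros ha.
  set (q := fun k => (/ 4) ^ k * bes (a + / 2) k).
  assert (hq : entire q).
  { apply (entire_dominated (bes (a + / 2)) _ 1); [apply bes_entire; lra|intros k].
    unfold q; rewrite Rabs_mult; apply Rmult_le_compat_r; [apply Rabs_pos|].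
    rewrite Rabs_pos_eq by (apply pow_le; lra).
    rewrite pow_inv, <- Rinv_1; apply Rinv_le_contravar; [lra|apply pow_R1_Rle; lra]. }
  assert (e : J (a + / 2) (y / 4) = PSeries q y).
  { unfold J, PSeries; apply Series_ext; intros k; unfold q, Rdiv.
    rewrite Rpow_mult_distr; ring. }
  rewrite e, <- PSeries_mult by (apply entire_CV_radius, hq).
  apply PSeries_ext; intros n; symmetry; apply (bes_square_coef a n ha).
Qed.

(** * The Gamma integral and BesselJ *)

Definition gamma_fun (s t : R) : R := Rpower t (s - 1) * exp (- t).

Lemma gamma_fun_pos s t : 0 < gamma_fun s t.
Proof. apply Rmult_lt_0_compat; apply exp_pos. Qed.

Lemma gamma_fun_continuous s t : 0 < t -> continuous (gamma_fun s) t.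
Proof.
  intros ht; apply (ex_derive_continuous (gamma_fun s) t).
  unfold gamma_fun, Rpower; auto_derive; exact ht.
Qed.

Lemma gamma_fun_ex_RInt s u v : 0 < u <= v -> ex_RInt (gamma_fun s) u v.
Proof.
  intros h; apply (@ex_RInt_continuous R_CompleteNormedModule).
  intros z; rewrite Rmin_left, Rmax_right by lra; intros hz.
  apply gamma_fun_continuous; lra.
Qed.

(** The limit is the supremum of the increasing partial integrals; the second conclusion later
    yields positivity of the Gamma integral. *)
Lemma is_RInt_gen_pos_infty (f : R -> R) u B :
  (forall v, u <= v -> ex_RInt f u v) ->
  (forall t, u <= t -> 0 <= f t) ->
  (forall v, u <= v -> RInt f u v <= B) ->
  exists l, is_RInt_gen f (at_point u) (Rbar_locally p_infty) l /\
    forall v, u <= v -> RInt f u v <= l.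
Proof.
  intros hex hpos hB.
  set (P := fun z => exists v, u <= v /\ z = RInt f u v).
  destruct (completeness P) as [l [hl1 hl2]].
  - exists B; intros z [v [hv ->]]; auto.
  - exists (RInt f u u), u; split; [lra|reflexivity].
  - exists l; split; [|intros z hz; apply hl1; exists z; split; auto].
    intros Q [eps hQ].
    assert (hx : exists v0, u <= v0 /\ l - eps < RInt f u v0).
    { apply Classical_Prop.NNPP; intros hn.
      assert (l <= l - eps); [|pose proof (cond_pos eps); lra].
      apply hl2; intros z [v [hv ->]].
      apply Rnot_lt_le; intros hlt; apply hn; exists v; split; assumption. }
    destruct hx as [v0 [hv0 hlt]].
    exists (fun x => x = u) (fun v => v0 < v); [unfold at_point; reflexivity|exists v0; auto|].
    intros x v -> hv; simpl.
    exists (RInt f u v); split; [apply (@RInt_correct R_CompleteNormedModule), hex; lra|].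
    apply hQ; unfold ball; simpl; unfold AbsRing_ball, abs, minus, plus, opp; simpl.
    assert (RInt f u v <= l) by (apply hl1; exists v; split; [lra|reflexivity]).
    assert (hC : RInt f u v0 + RInt f v0 v = RInt f u v).
    { apply (RInt_Chasles f u v0 v); [apply hex; lra|].
      apply (ex_RInt_Chasles_2 f u v0 v); [lra|apply hex; lra]. }
    assert (0 <= RInt f v0 v).
    { apply RInt_ge_0; [lra| |intros; apply hpos; lra].
      apply (ex_RInt_Chasles_2 f u v0 v); [lra|apply hex; lra]. }
    apply Rabs_def1; lra.
Qed.

Lemma is_RInt_gen_at_right (f : R -> R) v B : 0 < v ->
  (forall u, 0 < u <= v -> ex_RInt f u v) ->
  (forall t, 0 < t <= v -> 0 <= f t) ->
  (forall u, 0 < u <= v -> RInt f u v <= B) ->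
  exists l, is_RInt_gen f (at_right 0) (at_point v) l /\
    forall u, 0 < u <= v -> RInt f u v <= l.
Proof.
  intros hv hex hpos hB.
  set (P := fun z => exists u, 0 < u <= v /\ z = RInt f u v).
  destruct (completeness P) as [l [hl1 hl2]].
  - exists B; intros z [u [hu ->]]; auto.
  - exists (RInt f v v), v; split; [lra|reflexivity].
  - exists l; split; [|intros z hz; apply hl1; exists z; split; auto].
    intros Q [eps hQ].
    assert (hx : exists u0, 0 < u0 <= v /\ l - eps < RInt f u0 v).
    { apply Classical_Prop.NNPP; intros hn.
      assert (l <= l - eps); [|pose proof (cond_pos eps); lra].
      apply hl2; intros z [u [hu ->]].
      apply Rnot_lt_le; intros hlt; apply hn; exists u; split; assumption. }
    destruct hx as [u0 [hu0 hlt]].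
    exists (fun u => 0 < u < u0) (fun x => x = v); [|reflexivity|].
    + exists (mkposreal u0 (proj1 hu0)); intros u hu hu1.
      unfold ball in hu; simpl in hu; unfold AbsRing_ball, abs, minus, plus, opp in hu;
        simpl in hu; apply Rabs_def2 in hu; lra.
    + intros u x hu ->; simpl.
      exists (RInt f u v); split; [apply (@RInt_correct R_CompleteNormedModule), hex; lra|].
      apply hQ; unfold ball; simpl; unfold AbsRing_ball, abs, minus, plus, opp; simpl.
      assert (RInt f u v <= l) by (apply hl1; exists u; split; [lra|reflexivity]).
      assert (hC : RInt f u u0 + RInt f u0 v = RInt f u v).
      { apply (RInt_Chasles f u u0 v); [|apply hex; lra].
        apply (ex_RInt_Chasles_1 f u u0 v); [lra|apply hex; lra]. }
      assert (0 <= RInt f u u0).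
      { apply RInt_ge_0; [lra| |intros; apply hpos; lra].
        apply (ex_RInt_Chasles_1 f u u0 v); [lra|apply hex; lra]. }
      apply Rabs_def1; lra.
Qed.

Lemma gamma_fun_le s : exists K, 0 < K /\
  forall t, 1 <= t -> gamma_fun s t <= K * exp (- t / 2).
Proof.
  (* From [ln t <= t / c + ln c] one gets [t^m <= c^m * exp (m t / c)], and this [c] makes
     [m / c <= 1/2], leaving half of the exponential decay. *)
  set (m := Rmax (s - 1) 0); set (c := 2 * m + 1).
  assert (hm : s - 1 <= m /\ 0 <= m) by (split; [apply Rmax_l|apply Rmax_r]).
  exists (exp (m * ln c)); split; [apply exp_pos|]; intros t ht.
  unfold gamma_fun, Rpower; rewrite <- !exp_plus.
  assert (hc : 1 <= c) by (unfold c; lra).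
  assert (hl0 : 0 <= ln t).
  { rewrite <- ln_1; destruct (Req_dec t 1) as [->|]; [lra|].
    left; apply ln_increasing; lra. }
  assert (hl : ln t <= t / c + ln c).
  { replace t with (t / c * c) at 1 by (field; lra).
    assert (h0 : 0 < t / c) by (apply Rdiv_lt_0_compat; lra).
    rewrite ln_mult by lra.
    pose proof (exp_ineq1_le (ln (t / c))) as h; rewrite exp_ln in h by exact h0; lra. }
  assert (h1 : (s - 1) * ln t <= m * ln t) by (apply Rmult_le_compat_r; lra).
  assert (h2 : m * ln t <= m * (t / c + ln c)) by (apply Rmult_le_compat_l; lra).
  assert (h3 : m * (t / c) <= t / 2).
  { replace (m * (t / c)) with (m / c * t) by (field; lra).
    assert (m / c <= / 2) by (apply Rle_div_l; unfold c; lra); nra. }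
  assert (h4 : (s - 1) * ln t + - t <= m * ln c + - t / 2) by lra.
  destruct h4 as [h4|h4]; [left; apply exp_increasing, h4|rewrite h4; lra].
Qed.

(** [RInt_gen] is total, so [Gamma s] carries information only once convergence is known. The
    integral is split at 1, with comparison functions [t^(s - 1)] and [K exp (- t / 2)]; positivity
    comes from [[1, 2]]. *)
Lemma gamma_exists s : 0 < s -> exists l, 0 < l /\
  is_RInt_gen (gamma_fun s) (at_right 0) (Rbar_locally p_infty) l.
Proof.
  intros hs.
  destruct (gamma_fun_le s) as [K [hK hle]].
  destruct (is_RInt_gen_pos_infty (gamma_fun s) 1 (2 * K)) as [l2 [hl2 hl2']].
  - intros; apply gamma_fun_ex_RInt; lra.
  - intros; left; apply gamma_fun_pos.
  - intros v hv.
    assert (hI : is_RInt (fun t => K * exp (- t / 2)) 1 v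
                   (-2 * K * exp (- v / 2) - -2 * K * exp (- (1) / 2))).
    { apply (is_RInt_derive (fun t => -2 * K * exp (- t / 2))).
      - intros t _; auto_derive; [exact I|unfold Rdiv; field].
      - intros t _; apply (ex_derive_continuous (fun t => K * exp (- t / 2))).
        auto_derive; exact I. }
    apply Rle_trans with (RInt (fun t => K * exp (- t / 2)) 1 v).
    + apply RInt_le; [exact hv|apply gamma_fun_ex_RInt; lra|eexists; exact hI|].
      intros t ht; apply hle; lra.
    + rewrite (is_RInt_unique _ _ _ _ hI).
      assert (exp (- (1) / 2) <= 1).
      { apply Rle_trans with (exp 0); [left; apply exp_increasing; lra|].
        rewrite exp_0; lra. }
      pose proof (exp_pos (- v / 2)).
      assert (0 <= K * exp (- v / 2)) by nra.
      assert (K * exp (- (1) / 2) <= K) by nra.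
      lra.
  - destruct (is_RInt_gen_at_right (gamma_fun s) 1 (/ s) Rlt_0_1) as [l1 [hl1 hl1']].
    + intros; apply gamma_fun_ex_RInt; lra.
    + intros; left; apply gamma_fun_pos.
    + intros u hu.
      assert (hI : is_RInt (fun t => Rpower t (s - 1)) u 1
                     (/ s * Rpower 1 s - / s * Rpower u s)).
      { apply (is_RInt_derive (fun t => / s * Rpower t s));
          intros t; rewrite Rmin_left, Rmax_right by lra; intros ht.
        - replace (Rpower t (s - 1)) with (/ s * (s * Rpower t s / t)).
          + apply (is_derive_scal (fun t => Rpower t s)), is_derive_Rpower; lra.
          + unfold Rminus; rewrite Rpower_plus, (Rpower_Ropp _ 1), Rpower_1 by lra.
            field; lra.
        - apply (ex_derive_continuous (fun t => Rpower t (s - 1))).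
          eexists; apply is_derive_Rpower; lra. }
      apply Rle_trans with (RInt (fun t => Rpower t (s - 1)) u 1).
      * apply RInt_le; [lra|apply gamma_fun_ex_RInt; lra|eexists; exact hI|].
        intros t ht; unfold gamma_fun; rewrite <- (Rmult_1_r (Rpower t (s - 1))) at 2.
        apply Rmult_le_compat_l; [left; apply exp_pos|].
        rewrite <- exp_0; left; apply exp_increasing; lra.
      * rewrite (is_RInt_unique _ _ _ _ hI).
        replace (Rpower 1 s) with 1 by (unfold Rpower; rewrite ln_1, Rmult_0_r, exp_0; ring).
        assert (0 < / s) by (apply Rinv_0_lt_compat, hs).
        assert (0 < Rpower u s) by apply exp_pos; nra.
    + exists (l1 + l2); split.
      * specialize (hl1' 1 ltac:(lra)); rewrite RInt_point in hl1'.
        change (0 <= l1) in hl1'.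
        specialize (hl2' 2 ltac:(lra)).
        assert (0 < RInt (gamma_fun s) 1 2).
        { apply RInt_gt_0; [lra|intros; apply gamma_fun_pos|].
          intros; apply gamma_fun_continuous; lra. }
        lra.
      * apply (is_RInt_gen_Chasles (gamma_fun s) 1 l1 l2 hl1 hl2).
Qed.

Lemma Gamma_eq s l :
  is_RInt_gen (gamma_fun s) (at_right 0) (Rbar_locally p_infty) l -> Gamma s = l.
Proof. intros h; apply is_RInt_gen_unique, h. Qed.

Lemma Gamma_pos s : 0 < s -> 0 < Gamma s.
Proof.
  intros hs; destruct (gamma_exists s hs) as [l [hl h]].
  rewrite (Gamma_eq s l h); exact hl.
Qed.

(** Integration by parts in derivative form: [t^s exp (- t)] has derivative
    [s gamma_fun s - gamma_fun (s + 1)] and vanishes at both ends. *)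
Lemma Gamma_succ s : 0 < s -> Gamma (s + 1) = s * Gamma s.
Proof.
  intros hs.
  destruct (gamma_exists s hs) as [l [_ h]].
  destruct (gamma_exists (s + 1) ltac:(lra)) as [l' [_ h']].
  rewrite (Gamma_eq _ _ h), (Gamma_eq _ _ h').
  assert (hd : forall t, 0 < t ->
    is_derive (gamma_fun (s + 1)) t (s * gamma_fun s t - gamma_fun (s + 1) t)).
  { intros t ht; unfold gamma_fun.
    replace (s + 1 - 1) with s by ring.
    assert (e : Rpower t (s - 1) = Rpower t s / t).
    { unfold Rminus; rewrite Rpower_plus, (Rpower_Ropp _ 1), Rpower_1 by lra.
      reflexivity. }
    rewrite e.
    unfold Rpower; auto_derive; [exact ht|field; lra]. }
  assert (hpos : filter_prod (at_right 0) (Rbar_locally p_infty)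
    (fun ab => forall x, Rmin (fst ab) (snd ab) <= x <= Rmax (fst ab) (snd ab) -> 0 < x)).
  { exists (fun u => 0 < u) (fun v => 0 < v).
    - exists (mkposreal 1 Rlt_0_1); intros u _ hu; exact hu.
    - exists 0; auto.
    - intros u v hu hv x [hx _]; simpl in hx.
      eapply Rlt_le_trans; [|exact hx]; apply Rmin_glb_lt; assumption. }
  assert (hD : is_RInt_gen (Derive (gamma_fun (s + 1))) (at_right 0)
                 (Rbar_locally p_infty) (0 - 0)).
  { apply is_RInt_gen_Derive.
    - revert hpos; apply filter_imp; intros ab hab x hx.
      eexists; apply hd, hab, hx.
    - revert hpos; apply filter_imp; intros ab hab x hx.
      specialize (hab x hx).
      apply (continuous_ext_loc _ (fun t => s * gamma_fun s t - gamma_fun (s + 1) t)).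
      + exists (mkposreal x hab); intros t ht.
        unfold ball in ht; simpl in ht; unfold AbsRing_ball, abs, minus, plus, opp in ht;
          simpl in ht; apply Rabs_def2 in ht.
        symmetry; apply is_derive_unique, hd; lra.
      + apply (continuous_minus (fun t => s * gamma_fun s t) (gamma_fun (s + 1))).
        * apply (continuous_mult (fun _ => s) (gamma_fun s)); [apply continuous_const|].
          apply gamma_fun_continuous, hab.
        * apply gamma_fun_continuous, hab.
    - intros Q [eps hQ].
      (* The radius is [eps^(1/s)], so that [t^s < eps]. *)
      exists (mkposreal _ (exp_pos (/ s * ln eps))); intros t ht ht0.
      unfold ball in ht; simpl in ht; unfold AbsRing_ball, abs, minus, plus, opp in ht;
        simpl in ht; apply Rabs_def2 in ht.
      apply hQ; unfold ball; simpl; unfold AbsRing_ball, abs, minus, plus, opp; simpl.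
      pose proof (gamma_fun_pos (s + 1) t) as hg.
      assert (gamma_fun (s + 1) t < eps).
      { unfold gamma_fun; replace (s + 1 - 1) with s by ring.
        assert (Rpower t s < eps).
        { replace (pos eps) with (Rpower (Rpower eps (/ s)) s)
            by (rewrite Rpower_mult, Rinv_l, Rpower_1; try lra; apply cond_pos).
          unfold Rpower at 1 2; apply exp_increasing, Rmult_lt_compat_l; [exact hs|].
          apply ln_increasing; [exact ht0|]; unfold Rpower; lra. }
        assert (exp (- t) < 1) by (rewrite <- exp_0; apply exp_increasing; lra).
        pose proof (exp_pos (s * ln t)); pose proof (exp_pos (- t)).
        unfold Rpower in *; nra. }
      apply Rabs_def1; lra.
    - intros Q [eps hQ].
      destruct (gamma_fun_le (s + 1)) as [K [hK hle]].
      exists (Rmax 1 (2 * K / eps)); intros t ht.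
      assert (ht1 : 1 < t) by (eapply Rle_lt_trans; [apply Rmax_l|exact ht]).
      assert (ht2 : 2 * K / eps < t) by (eapply Rle_lt_trans; [apply Rmax_r|exact ht]).
      apply hQ; unfold ball; simpl; unfold AbsRing_ball, abs, minus, plus, opp; simpl.
      pose proof (gamma_fun_pos (s + 1) t) as hg; specialize (hle t ltac:(lra)).
      pose proof (cond_pos eps) as he.
      assert (K * exp (- t / 2) < eps).
      { replace (- t / 2) with (- (t / 2)) by field; rewrite exp_Ropp.
        pose proof (exp_ineq1_le (t / 2)) as hx.
        apply (Rmult_lt_reg_r (exp (t / 2))); [apply exp_pos|].
        rewrite Rmult_assoc, Rinv_l by (pose proof (exp_pos (t / 2)); lra).
        apply (Rmult_lt_compat_r eps) in ht2; [|exact he].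
        replace (2 * K / eps * eps) with (2 * K) in ht2 by (field; lra).
        nra. }
      apply Rabs_def1; lra. }
  pose proof (is_RInt_gen_minus _ _ _ _ (is_RInt_gen_scal _ s _ h) h') as hm.
  assert (hm' : is_RInt_gen (Derive (gamma_fun (s + 1))) (at_right 0)
                  (Rbar_locally p_infty) (minus (scal s l) l')).
  { revert hm; apply is_RInt_gen_ext; revert hpos; apply filter_imp.
    intros ab hab x hx; symmetry; apply is_derive_unique, hd, hab; lra. }
  pose proof (is_RInt_gen_unique _ _ hD) as e1.
  pose proof (is_RInt_gen_unique _ _ hm') as e2.
  rewrite e1 in e2; change (0 - 0 = s * l - l') in e2; lra.
Qed.

Lemma Gamma_poch s k : 0 < s -> Gamma (INR k + s) = poch s k * Gamma s.
Proof.
  intros hs; induction k as [|k IH]; [simpl; rewrite Rplus_0_l; ring|].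
  pose proof (pos_INR k).
  replace (INR (S k) + s) with (INR k + s + 1) by (rewrite S_INR; ring).
  rewrite Gamma_succ, IH by lra; simpl; ring.
Qed.

(** The prefactor is positive, so positive zeros of the Bessel function of order [d - 1] correspond
    to zeros of [J d] under [y = x^2 / 4]. *)
Lemma BesselJ_eq d x : 0 < d -> 0 < x ->
  BesselJ (d - 1) x = Rpower (x / 2) (d - 1) / Gamma d * J d (x ^ 2 / 4).
Proof.
  intros hd hx; unfold BesselJ, J, PSeries.
  rewrite <- Series_scal_l; apply Series_ext; intros k.
  replace (INR k + (d - 1) + 1) with (INR k + d) by ring.
  rewrite Gamma_poch, Rpower_plus by exact hd.
  replace (2 * INR k) with (INR (2 * k)) by (rewrite mult_INR; simpl; ring).
  rewrite Rpower_pow, pow_mult by lra.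
  replace ((x / 2) ^ 2) with (x ^ 2 / 4) by field.
  pose proof (Gamma_pos d hd); pose proof (poch_pos d k hd); pose proof (INR_fact_lt_0 k).
  unfold bes; field; repeat split; lra.
Qed.

Lemma J_zero_of_first_zero d j : 0 < d -> is_first_pos_zero (d - 1) j ->
  0 < j /\ J d (j ^ 2 / 4) = 0.
Proof.
  intros hd [hj [h0 _]]; split; [exact hj|].
  rewrite BesselJ_eq in h0 by assumption.
  apply Rmult_integral in h0; destruct h0 as [h0|h0]; [exfalso|exact h0].
  revert h0; apply Rgt_not_eq, Rdiv_lt_0_compat; [apply exp_pos|apply Gamma_pos, hd].
Qed.

(** * Sign changes of Phi *)

Lemma Phi_eq a b c x : Phi a b c x = PSeries (hyp a b c) (x ^ 2 / 4).
Proof.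
  unfold Phi, F12, PSeries; apply Series_ext; intros k; unfold hyp.
  replace (- x ^ 2 / 4) with (-1 * (x ^ 2 / 4)) by field.
  rewrite Rpow_mult_distr; unfold Rdiv; ring.
Qed.

Lemma hyp_sym a b c k : hyp a b c k = hyp a c b k.
Proof. unfold hyp; f_equal; ring. Qed.

Lemma Phi_sym a b c x : Phi a b c x = Phi a c b x.
Proof. rewrite !Phi_eq; apply PSeries_ext; intros; apply hyp_sym. Qed.

Lemma hyp_0 a b c : hyp a b c O = 1.
Proof. unfold hyp; simpl; field. Qed.

Lemma entire_pos_of_no_zero p y : entire p -> 0 < p O -> 0 <= y ->
  (forall z, 0 < z <= y -> PSeries p z <> 0) -> 0 < PSeries p y.
Proof.
  intros hp hp0 hy h; apply Rnot_le_lt; intros hle.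
  pose proof (PSeries_0 p) as e0.
  destruct (IVT_gen (PSeries p) 0 y 0 (entire_continuity p hp)) as [z [hz ez]].
  { rewrite e0, Rmin_right, Rmax_left; lra. }
  rewrite Rmin_left, Rmax_right in hz by exact hy.
  destruct (Req_dec z 0) as [->|hz0]; [lra|].
  apply (h z); [lra|exact ez].
Qed.

Lemma sqrt_param y : 0 < y -> exists x, 0 < x /\ x ^ 2 / 4 = y.
Proof.
  intros hy; exists (2 * sqrt y); split.
  - pose proof (sqrt_lt_R0 y hy); lra.
  - replace ((2 * sqrt y) ^ 2 / 4) with (sqrt y * sqrt y) by field.
    apply sqrt_sqrt; lra.
Qed.

Lemma Phi_pos_of_no_zero a b c x : 0 < a -> 0 < b -> 0 < c ->
  (forall t, 0 < t <= x -> Phi a b c t <> 0) ->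
  forall y, 0 <= y <= x ^ 2 / 4 -> 0 <= x -> 0 < PSeries (hyp a b c) y.
Proof.
  intros ha hb hc h y hy hx.
  apply entire_pos_of_no_zero; [apply hyp_entire; auto|rewrite hyp_0; lra|lra|].
  intros z hz; destruct (sqrt_param z (proj1 hz)) as [t [ht <-]].
  rewrite <- Phi_eq; apply h; split; [exact ht|nra].
Qed.

Lemma hyp_nonneg_of_Phi a b c :
  (forall x, 0 < x -> 0 <= Phi a b c x) -> forall y, 0 <= y -> 0 <= PSeries (hyp a b c) y.
Proof.
  intros h y hy; destruct (Req_dec y 0) as [->|hy0].
  - rewrite PSeries_0, hyp_0; lra.
  - destruct (sqrt_param y ltac:(lra)) as [x [hx <-]]; rewrite <- Phi_eq; auto.
Qed.

(** A positive value always exists near 0, where the series starts from 1, so only a negative one is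
    at stake. *)
Lemma Phi_alternates a b c : 0 < a -> 0 < b -> 0 < c ->
  ~ (forall y, 0 <= y -> 0 <= PSeries (hyp a b c) y) -> alternates (Phi a b c).
Proof.
  intros ha hb hc hn; split.
  - apply Classical_Prop.NNPP; intros hneg.
    assert (hle : forall y, 0 < y -> PSeries (hyp a b c) y <= 0).
    { intros y hy; destruct (sqrt_param y hy) as [x [hx <-]].
      apply Rnot_lt_le; intros hlt; apply hneg; exists x; rewrite Phi_eq; auto. }
    pose proof (hyp_entire a b c ha hb hc) as hp.
    destruct (entire_continuity _ hp 0 1 Rlt_0_1) as [al [hal hc']].
    assert (hcl : R_dist (PSeries (hyp a b c) (al / 2)) (PSeries (hyp a b c) 0) < 1).
    { apply hc'; split; [split; [exact I|lra]|].
      simpl; unfold R_dist; rewrite Rminus_0_r, Rabs_pos_eq; lra. }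
    unfold R_dist in hcl; rewrite PSeries_0, hyp_0 in hcl; apply Rabs_def2 in hcl.
    specialize (hle (al / 2) ltac:(lra)); lra.
  - apply Classical_Prop.NNPP; intros hneg; apply hn, hyp_nonneg_of_Phi.
    intros x hx; apply Rnot_lt_le; intros hlt; apply hneg; exists x; auto.
Qed.

Lemma Phi_case_i a b c : 0 < a -> 0 < b -> 0 < c -> b <= a ->
  alternates (Phi a b c) /\
  forall j, is_first_pos_zero (c - 1) j -> exists x, 0 < x <= j /\ Phi a b c x = 0.
Proof.
  intros ha hb hc hba.
  pose proof (hyp_entire a b c ha hb hc) as hp.
  assert (e : forall y, PSeries (beta b a (hyp a b c)) y = J c y)
    by (intros; apply PSeries_ext; intros; apply beta_hyp_bes; assumption).
  split.
  - apply Phi_alternates; auto; intros h.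
    destruct (J_takes_negative c hc) as [y [hy hJ]].
    pose proof (beta_nonneg b a _ y ltac:(lra) hp (fun z hz => h z (proj1 hz)) y
                  ltac:(lra)) as h0.
    rewrite e in h0; lra.
  - intros j hj; destruct (J_zero_of_first_zero c j hc hj) as [hj0 hJ].
    apply Classical_Prop.NNPP; intros hn.
    assert (h0 : 0 < PSeries (beta b a (hyp a b c)) (j ^ 2 / 4)).
    (* Absence of zeros on the closed range makes [Phi] strictly positive up to [j], so the strict
       multiplier lemma applies, including when [b = a]. *)
    { apply (beta_pos b a _ (j ^ 2 / 4)); [lra|exact hp| |nra].
      intros y hy; apply (Phi_pos_of_no_zero a b c j); auto; [|lra].
      intros t ht e0; apply hn; exists t; split; assumption. }
    rewrite e in h0; lra.
Qed.

(** The strict bound on [b + c] makes at least one of the two raisings strict. That one is applied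
    first, through [beta_strict], and the other, possibly trivial, preserves positivity through
    [beta_pos]. *)
Lemma hyp_nonneg_square a b c Y : 0 < a -> 0 < b -> 0 < c ->
  b <= a + 1 / 2 -> c <= 2 * a -> b + c < 3 * a + 1 / 2 -> 0 <= Y ->
  (forall y, 0 <= y <= Y -> 0 <= PSeries (hyp a b c) y) ->
  0 < J (a + / 2) (Y / 4) * J (a + / 2) (Y / 4).
Proof.
  intros ha hb hc hba hca hsum hY h.
  pose proof (hyp_entire a b c ha hb hc) as hp.
  assert (hp0 : 0 < hyp a b c O) by (rewrite hyp_0; lra).
  rewrite <- J_square by exact ha.
  assert (e : forall k, hyp a (a + / 2) (2 * a) k
                        = beta b (a + / 2) (beta c (2 * a) (hyp a b c)) k).
  { intros k; unfold beta, hyp.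
    pose proof (poch_pos b k hb); pose proof (poch_pos c k hc).
    pose proof (poch_pos (a + / 2) k ltac:(lra)); pose proof (poch_pos (2 * a) k ltac:(lra)).
    pose proof (INR_fact_lt_0 k); field; lra. }
  destruct (Rlt_le_dec c (2 * a)) as [hlt|hge].
  - rewrite (PSeries_ext _ _ Y e).
    apply (beta_pos _ _ _ Y); [lra|apply beta_entire; auto; lra| |lra].
    intros y hy; apply (beta_strict _ _ _ Y); auto; lra.
  - rewrite (PSeries_ext _ (beta c (2 * a) (beta b (a + / 2) (hyp a b c)))).
    + apply (beta_pos _ _ _ Y); [lra|apply beta_entire; auto; lra| |lra].
      intros y hy; apply (beta_strict _ _ _ Y); auto; lra.
    + intros k; rewrite e; unfold beta; ring.
Qed.

Lemma Phi_case_ii a b c : 0 < a -> 0 < b -> 0 < c ->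
  b <= a + 1 / 2 -> c <= 2 * a -> b + c < 3 * a + 1 / 2 ->
  alternates (Phi a b c) /\
  forall j, is_first_pos_zero (a - 1 / 2) j ->
    exists x, 0 < x < 2 * j /\ Phi a b c x = 0.
Proof.
  intros ha hb hc hba hca hsum.
  assert (hA : 0 < a + / 2) by lra.
  split.
  - apply Phi_alternates; auto; intros h.
    destruct (J_takes_negative _ hA) as [y [hy hJ]].
    (* No first zero is given here, so one is produced: [J] starts from 1 and is negative at [y].
       The square is then evaluated at [4 z]. *)
    destruct (Classical_Prop.classic (exists z, 0 < z <= y /\ J (a + / 2) z = 0))
      as [[z [hz ez]]|hn].
    + pose proof (hyp_nonneg_square a b c (4 * z) ha hb hc hba hca hsum ltac:(lra)
                    (fun t ht => h t (proj1 ht))) as h0.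
      replace (4 * z / 4) with z in h0 by field; rewrite ez in h0; lra.
    + assert (0 < J (a + / 2) y); [|lra].
      apply entire_pos_of_no_zero; [apply bes_entire, hA| |lra|].
      * unfold bes; simpl; lra.
      * intros z hz ez; apply hn; exists z; split; assumption.
  - intros j hj.
    replace (a - 1 / 2) with (a + / 2 - 1) in hj by field.
    destruct (J_zero_of_first_zero _ j hA hj) as [hj0 hJ].
    apply Classical_Prop.NNPP; intros hn.
    (* The endpoint [x = 2 j] corresponds to [y = j^2], which the open interval excludes. There
       continuity still gives nonnegativity, and the strictness of [hyp_nonneg_square] suffices for
       the contradiction. *)
    assert (hpos : forall y, 0 <= y < j ^ 2 -> 0 < PSeries (hyp a b c) y).
    { intros y hy.
      apply entire_pos_of_no_zero; [apply hyp_entire; auto|rewrite hyp_0; lra|lra|].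
      intros z hz ez; destruct (sqrt_param z (proj1 hz)) as [t [ht et]].
      apply hn; exists t; split; [split; [exact ht|nra]|].
      rewrite Phi_eq, et; exact ez. }
    assert (hlast : 0 <= PSeries (hyp a b c) (j ^ 2)).
    { apply Rnot_lt_le; intros hlt.
      destruct (entire_continuity _ (hyp_entire a b c ha hb hc) (j ^ 2)
                  (- PSeries (hyp a b c) (j ^ 2)) ltac:(lra)) as [al [hal hc']].
      assert (hj2 : 0 < j ^ 2) by nra.
      set (t := Rmax (j ^ 2 - al / 2) 0).
      assert (ht : 0 <= t < j ^ 2).
      { split; [apply Rmax_r|apply Rmax_lub_lt; lra]. }
      assert (ht2 : j ^ 2 - al / 2 <= t) by apply Rmax_l.
      assert (hcl : R_dist (PSeries (hyp a b c) t) (PSeries (hyp a b c) (j ^ 2))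
                    < - PSeries (hyp a b c) (j ^ 2)).
      { apply hc'; split; [split; [exact I|lra]|].
        change (Rabs (t - j ^ 2) < al); apply Rabs_def1; lra. }
      unfold R_dist in hcl; apply Rabs_def2 in hcl.
      specialize (hpos t ht); lra. }
    pose proof (hyp_nonneg_square a b c (j ^ 2) ha hb hc hba hca hsum ltac:(nra)) as h0.
    rewrite hJ in h0.
    assert (0 < 0 * 0); [apply h0|lra].
    intros y hy; destruct (Req_dec y (j ^ 2)) as [->|hne]; [exact hlast|].
    left; apply hpos; lra.
Qed.

Lemma alternates_ext f g : (forall x, f x = g x) -> alternates f -> alternates g.
Proof.
  intros h [[x hx] [y hy]]; split; [exists x|exists y]; rewrite <- h; assumption.
Qed.

Theorem theorem1 (a b c : R) (ha : 0 < a) (hb : 0 < b) (hc : 0 < c) :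
  (in_P12 a b c -> a < b /\ a < c /\ 3 * a + 1 / 2 <= b + c) /\
  (b <= a ->
     alternates (Phi a b c) /\
     forall j, is_first_pos_zero (c - 1) j ->
       exists x, 0 < x <= j /\ Phi a b c x = 0) /\
  (c <= a ->
     alternates (Phi a b c) /\
     forall j, is_first_pos_zero (b - 1) j ->
       exists x, 0 < x <= j /\ Phi a b c x = 0) /\
  (((b <= a + 1 / 2 /\ c <= 2 * a) \/ (b <= 2 * a /\ c <= a + 1 / 2)) ->
   b + c < 3 * a + 1 / 2 ->
     alternates (Phi a b c) /\
     forall j, is_first_pos_zero (a - 1 / 2) j ->
       exists x, 0 < x < 2 * j /\ Phi a b c x = 0).
Proof.
  assert (hi : c <= a -> alternates (Phi a b c) /\
     forall j, is_first_pos_zero (b - 1) j ->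
       exists x, 0 < x <= j /\ Phi a b c x = 0).
  { intros hca; destruct (Phi_case_i a c b ha hc hb hca) as [h1 h2]; split.
    - apply (alternates_ext (Phi a c b)); [intros; apply Phi_sym|exact h1].
    - intros j hj; destruct (h2 j hj) as [x [hx e]]; exists x.
      rewrite Phi_sym; split; assumption. }
  split; [|split; [|split]].
  - intros [_ [_ [_ hP]]].
    assert (hno : alternates (Phi a b c) -> False).
    { intros [_ [y [hy hy']]]; specialize (hP y hy); lra. }
    assert (hab : a < b).
    { apply Rnot_le_lt; intros h; apply hno, Phi_case_i; assumption. }
    assert (hac : a < c).
    { apply Rnot_le_lt; intros h; apply hno, hi, h. }
    assert (hn : forall y, 0 <= y -> 0 <= PSeries (hyp a b c) y).
    { apply hyp_nonneg_of_Phi; intros x hx; left; apply hP, hx. }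
    repeat split; [exact hab|exact hac|].
    (* The telescoping bound behind [hyp_nonneg_sum] uses the order [b <= c]; the other case follows
       by symmetry. *)
    destruct (Rle_lt_dec b c) as [hbc|hcb].
    + apply hyp_nonneg_sum; assumption.
    + rewrite (Rplus_comm b); apply hyp_nonneg_sum; [assumption|assumption|lra|].
      intros y hy; rewrite (PSeries_ext _ _ y (hyp_sym a c b)); auto.
  - apply Phi_case_i; assumption.
  - exact hi.
  - intros [[h1 h2]|[h1 h2]] hsum; [apply Phi_case_ii; assumption|].
    destruct (Phi_case_ii a c b ha hc hb h2 h1 ltac:(lra)) as [h3 h4]; split.
    + apply (alternates_ext (Phi a c b)); [intros; apply Phi_sym|exact h3].
    + intros j hj; destruct (h4 j hj) as [x [hx e]]; exists x.
      rewrite Phi_sym; split; assumption.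
Qed.
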